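(* Let $g\ge2$ and $k\ge1$ be integers, and let $\lambda$ be a Young diagram with $3k$ boxes whose first row has length $\lambda_1>g$. (i) For all $\xi\in E_\lambda\subset\mathbb Q\mathcal D^\ell(6k)$, the relation $\alpha_{\bar\Gamma_\xi}=0$ holds in $\mathcal R^{2k}(\mathcal M_g)$ (where $\mathcal R^*(\mathcal M_g)$ is regarded as a subalgebra of $\mathcal R^*(\mathcal M_{g,*})$ via $p^*$). (ii) For all $\xi\in E_\lambda\subset\mathbb Q\mathcal D^\ell(6k)$ and all $0\le p\le 2k$, the relation $\alpha_{\Gamma_\xi^{(p)}}=0$ holds in $\mathcal R^{2k}(\mathcal M_{g,*})$.
   Context: Tautological algebras. $\mathcal M_g$ is the mapping class group of a closed oriented surface $\Sigma_g$, $\mathcal M_{g,*}$ the one relative to a base point, and $p:\mathcal M_{g,*}\to\mathcal M_g$ the forgetful map. $e\in H^2(\mathcal M_{g,*};\mathbb Q)$ is the Euler class (of the vertical tangent bundle of the universal surface bundle) and $e_i\in H^{2i}(\mathcal M_g;\mathbb Q)$ is the $i$-th Mumford–Morita–Miller class, the fiber integral of $e^{i+1}$. $\mathcal R^*(\mathcal M_g)\subset H^*(\mathcal M_g;\mathbb Q)$ is the subalgebra generated by the $e_i$, and $\mathcal R^*(\mathcal M_{g,*})\subset H^*(\mathcal M_{g,*};\mathbb Q)$ the subalgebra generated by $e$ and the $e_i$; superscripts denote cohomological degree. $p^*$ induces an injection $\mathcal R^*(\mathcal M_g)\subset\mathcal R^*(\mathcal M_{g,*})$. Chord diagrams and $E_\lambda$.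 A linear chord diagram $C\in\mathcal D^\ell(6k)$ is a partition of $\{1,\dots,6k\}$ into $3k$ pairs (chords) $\{i_s,j_s\}$, written with $i_1<\cdots<i_{3k}$, $i_s<j_s$; $\mathrm{sgn}\,C$ is the sign of the permutation $(1,2,\dots,6k)\mapsto(i_1,j_1,\dots,i_{3k},j_{3k})$. $\mathbb Q\mathcal D^\ell(6k)$ is the $\mathbb Q$-vector space with basis $\mathcal D^\ell(6k)$, with the natural $\mathfrak S_{6k}$-action; it is the multiplicity-free direct sum, over Young diagrams $\lambda=[\lambda_1\cdots\lambda_h]$ with $3k$ boxes, of irreducible submodules $E_\lambda$ isomorphic to the irreducible representation of $\mathfrak S_{6k}$ corresponding to $2\lambda=[2\lambda_1\cdots2\lambda_h]$ (convention: $[6k]$ is the trivial representation). Graphs. $\mathcal G$ is the set of isomorphism classes of connected trivalent graphs (loops and multiple edges allowed). $\mathbb Q[\Gamma;\Gamma\in\mathcal G]$ is the polynomial algebra on $\mathcal G$, with degree of a graph equal to its number of vertices and product equal to disjoint union; its degree $2k$ part $\mathbb Q[\Gamma;\Gamma\in\mathcal G]^{(2k)}$ is the span of all (possibly disconnected) trivalent graphs with $2k$ vertices. For $C\in\mathcal D^\ell(6k)$, $\Gamma_C$ is the trivalent graph obtained from the graph $C$ (vertices $1,\dots,6k$, edges the chords) by joining the three vertices in each of $\{1,2,3\},\{4,5,6\},\dots,\{6k-2,6k-1,6k\}$ to a single vertex. Extending linearly gives $\xi\mapsto\Gamma_\xi$, $\mathbb Q\mathcal D^\ell(6k)\to\mathbb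 Q[\Gamma;\Gamma\in\mathcal G]^{(2k)}$. Graphical contraction. Let $\Gamma$ be a trivalent graph with $2k$ vertices and vertex set $V_\Gamma$, and let $F\subset V_\Gamma$ have $p$ elements. $\mathcal P(F)$ is the set of choices $\varpi$ assigning to each $v\in F$ a pair $\varpi(v)=\{a_v,b_v\}$ of two of the three half-edges at $v$. For $\varpi\in\mathcal P(F)$: at each $v\in F$ cut the edges containing $a_v$ and $b_v$ at one third of the way along from $v$, join the two short ends at $v$ into a loop at $v$, and join the two other cut ends to each other. After doing this at every $v\in F$ one obtains a trivalent graph $\Gamma_\varpi$ on the same vertices together with some disjoint circles without vertices, which are discarded; $\ell(\varpi)$ is the number of these circles. (Equivalently: let $S=\bigcup_{v\in F}\{a_v,b_v\}$. In $\Gamma_\varpi$, $a_v$ is matched with $b_v$ for $v\in F$; a half-edge $h\notin S$ is matched with the half-edge outside $S$ reached from $h$ by alternately following edges of $\Gamma$ and the pairs $\{a_v,b_v\}$; and $\ell(\varpi)$ is the number of closed cycles inside $S$ formed alternately by edges of $\Gamma$ and pairs $\{a_v,b_v\}$.) For $0\le p\le2k$, $$\Gamma^{(p)}=\frac1{(2g-2)^p}\sum_{F\subset V_\Gamma,\ |F|=p}\ \sum_{\varpi\in\mathcal P(F)}(-1)^p(-2g)^{\ell(\varpi)}\,\Gamma_\varpi,\qquad \bar\Gamma=\Gamma-\Gamma^{(1)}+\Gamma^{(2)}-\cdots+\Gamma^{(2k)},$$ extended linearly to $\mathbb Q[\Gamma;\Gamma\in\mathcal G]^{(2k)}$; thus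 $\Gamma_\xi^{(p)}$ and $\bar\Gamma_\xi$ are defined for $\xi\in\mathbb Q\mathcal D^\ell(6k)$, with $\Gamma^{(0)}_\xi=\Gamma_\xi$. The classes $\alpha_\Gamma$. Let $H_{\mathbb Q}=H_1(\Sigma_g;\mathbb Q)$ with intersection form $\mu$. Let $\tilde k\in H^1(\mathcal M_{g,*};\wedge^3H_{\mathbb Q})$ be the class of a crossed homomorphism $\mathcal M_{g,*}\to\wedge^3H_{\mathbb Q}$ extending the Johnson homomorphism of the Torelli subgroup (it exists and its class is unique), and $\tilde k^{2k}\in H^{2k}(\mathcal M_{g,*};\wedge^{2k}(\wedge^3H_{\mathbb Q}))$ its cup power. For $C\in\mathcal D^\ell(6k)$ let $\alpha_C:H_{\mathbb Q}^{\otimes6k}\to\mathbb Q$, $\alpha_C(u_1\otimes\cdots\otimes u_{6k})=\mathrm{sgn}\,C\prod_s\mu(u_{i_s},u_{j_s})$. Restricting along the antisymmetrization embedding $\wedge^{2k}(\wedge^3H_{\mathbb Q})\subset H_{\mathbb Q}^{\otimes6k}$ gives an $\mathrm{Sp}$-invariant form depending only on the isomorphism class of $\Gamma=\Gamma_C$, and $\alpha_\Gamma\in H^{2k}(\mathcal M_{g,*};\mathbb Q)$ denotes the image of $\tilde k^{2k}$ under this form (the overall normalization depends only on $k$ and is immaterial here). In other words $\alpha$ is the composition $\mathbb Q[\Gamma;\Gamma\in\mathcal G]\to(\wedge^*(\wedge^3H_{\mathbb Q}^* ))^{\mathrm{Sp}}\to H^*(\mathcal M_{g,*};\mathbb Q)$.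 It is known (Kawazumi–Morita) that $\alpha_\Gamma\in\mathcal R^{2k}(\mathcal M_{g,*})$, being given by an explicit polynomial in $\mathbb Q[g][e,e_1,e_2,\dots]$, and that $\alpha_{\bar\Gamma}$ lies in $\mathcal R^{2k}(\mathcal M_g)$. Extend $\alpha$ linearly to combinations of graphs. *)

(* Defs.v *)
From HB Require Import structures.
From mathcomp Require Import freeg.
From mathcomp Require Import all_boot all_order all_algebra all_fingroup.
From mathcomp Require Import generic_quotient zify.
From mathcomp Require Import boolp classical_sets functions reals topology normedtype.

Set Implicit Arguments.
Unset Strict Implicit.
Unset Printing Implicit Defensive.

Import Order.TTheory GRing.Theory Num.Theory.
Import numFieldNormedType.Exports.

Local Open Scope classical_set_scope.
Local Open Scope ring_scope.
Local Open Scope quotient_scope.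

Definition simplex (R : realType) (n : nat) : set 'rV[R]_n.+1 :=
  [set t | (forall i, 0 <= t 0 i) /\ \sum_i t 0 i = 1].
Arguments simplex : clear implicits.

Section Coface.
Variables (R : realType) (n : nat) (i : 'I_n.+2).

Definition coface_vec (t : 'rV[R]_n.+1) : 'rV[R]_n.+2 :=
  \row_j oapp (t 0) 0 (unlift i j).

Lemma coface_vecP (t : simplex R n) : coface_vec (val t) \in simplex R n.+1.
Proof.
have /set_mem[t0 t1] := valP t; apply/mem_set; split=> [j|].
  by rewrite mxE; case: unliftP => [k _|_] /=.
rewrite (bigD1_ord i) //= mxE unlift_none add0r -[RHS]t1.
by apply: eq_bigr => j _; rewrite mxE liftK.
Qed.

Definition coface (t : simplex R n) : simplex R n.+1 :=
  exist (fun u => u \in simplex R n.+1) _ (coface_vecP t).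

Lemma coface_continuous : continuous coface.
Proof.
apply: continuous_comp_initial => t.
apply: (@continuous_comp _ _ _ (val : simplex R n -> _) coface_vec).
  exact: initial_continuous.
move=> A [P nP PA].
exists (fun a b => P a (lift i b)) => [a b|s Ps].
  by have := nP a (lift i b); rewrite mxE liftK (ord1 a).
apply: PA => a b; rewrite (ord1 a) mxE; case: unliftP => [j ->|->] /=; first exact: Ps.
have := nP ord0 i; rewrite mxE unlift_none /=; exact: nbhs_singleton.
Qed.

HB.instance Definition _ :=
  isContinuous.Build (simplex R n) (simplex R n.+1) coface coface_continuous.
End Coface.
Arguments coface {R n} i t.

Section FreeModule.
Variables (A : nzRingType) (K : choiceType) (M : lmodType A).

HB.instance Definition _ (f : K -> M) :=
  GRing.isZmodMorphism.Build {freeg K / A} M (fglift f) (lift_is_additive f).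

Lemma fglift_scalable (f : K -> M) : scalable (fglift f).
Proof.
move=> a c; have -> : a *: c = \sum_(k <- freeg.dom c) << a * coeff k c *g k >>.
  by [].
rewrite -[in RHS](freeg_sumE c) !raddf_sum /=.
by apply: eq_bigr => s _; rewrite !liftU scalerA.
Qed.

HB.instance Definition _ (f : K -> M) :=
  GRing.isScalable.Build A {freeg K / A} M *:%R (fglift f) (fglift_scalable f).

Lemma freegUE (a : A) (k : K) : << a *g k >> = a *: << k >> :> {freeg K / A}.
Proof. by apply/eqP/freeg_eqP => x; rewrite coeffZ !coeffU mul1r. Qed.

Lemma eq_freeg_linear (f g : {linear {freeg K / A} -> M}) :
  (forall k, f << k >> = g << k >>) -> f =1 g.
Proof.
move=> fg c; rewrite -[c]freeg_sumE !raddf_sum; apply: eq_bigr => k _.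
by rewrite freegUE [LHS](linearZZ f) [RHS](linearZZ g) fg.
Qed.

End FreeModule.

Section SingularHomology.
Variables (A : nzRingType) (R : realType).
Implicit Types (X Y Z : topologicalType) (n : nat).

Definition singular_simplex X n : Type := continuousType (simplex R n) X.
HB.instance Definition _ X n := Choice.on (singular_simplex X n).

Definition chain X n := {freeg (singular_simplex X n) / A}.
HB.instance Definition _ X n := GRing.Lmodule.on (chain X n).

Definition face X n (i : 'I_n.+2) (s : singular_simplex X n.+1) :
  singular_simplex X n := s \o coface i.

Definition boundary X n : chain X n.+1 -> chain X n :=
  fglift (fun s => \sum_(i < n.+2) (-1) ^+ i *: << face i s >>).

Definition is_cycle X n (c : chain X n.+1) := boundary c = 0.
Definition is_boundary X n (c : chain X n) := exists b, boundary b = c.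
Definition homologous X n (c d : chain X n) := is_boundary (c - d).

Definition pushforward X Y n (f : continuousType X Y) : chain X n -> chain Y n :=
  fglift (fun s : singular_simplex X n => << (f \o s : singular_simplex Y n) >>).

HB.instance Definition _ X n := GRing.Linear.on (@boundary X n).
HB.instance Definition _ X Y n f := GRing.Linear.on (@pushforward X Y n f).

Lemma pushforward_id X n (c : chain X n) : pushforward idfun c = c.
Proof.
apply: (@eq_freeg_linear _ _ _ (@pushforward X X n idfun) idfun) => s.
by rewrite /= /pushforward liftU scale1r; congr << _ >>; apply/continuousEP.
Qed.

Lemma pushforward_comp X Y Z n (f : continuousType X Y) (g : continuousType Y Z)
    (c : chain X n) : pushforward (g \o f) c = pushforward g (pushforward f c).
Proof.
apply: (@eq_freeg_linear _ _ _ (@pushforward X Z n (g \o f))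
          (@pushforward Y Z n g \o @pushforward X Y n f)) => s.
rewrite /= /pushforward !liftU !scale1r liftU scale1r.
by congr << _ >>; apply/continuousEP.
Qed.

Lemma pushforward_boundary X Y n (f : continuousType X Y) (c : chain X n.+1) :
  pushforward f (boundary c) = boundary (pushforward f c).
Proof.
apply: (@eq_freeg_linear _ _ _ (@pushforward X Y n f \o @boundary X n)
          (@boundary Y n \o @pushforward X Y n.+1 f)) => s.
rewrite /= /boundary /pushforward !liftU !scale1r liftU scale1r linear_sum.
apply: eq_bigr => i _; rewrite linearZ_LR /= liftU scale1r; congr (_ *: << _ >>).
by apply/continuousEP.
Qed.

Lemma homologous_refl X n (c : chain X n) : homologous c c.
Proof. by exists 0; rewrite linear0 subrr. Qed.

Lemma homologous_sym X n (c d : chain X n) : homologous c d -> homologous d c.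
Proof. by move=> [b bE]; exists (- b); rewrite (linearN (@boundary X n)) /= bE opprB. Qed.

Lemma homologous_trans X n (c d e : chain X n) :
  homologous c d -> homologous d e -> homologous c e.
Proof.
move=> [b bE] [b' b'E]; exists (b + b').
by rewrite (linearD (@boundary X n)) /= bE b'E addrA subrK.
Qed.

Lemma pushforward_homologous X Y n (f : continuousType X Y) (c d : chain X n) :
  homologous c d -> homologous (pushforward f c) (pushforward f d).
Proof.
by move=> [b bE]; exists (pushforward f b); rewrite -pushforward_boundary bE linearB.
Qed.

End SingularHomology.

Definition unit_interval (R : realType) : set R := `[0, 1]%classic.
Arguments unit_interval : clear implicits.

Lemma pair_continuous (T U V : topologicalType) (f : T -> U) (g : T -> V) :
  continuous f -> continuous g -> continuous (fun p => (f p, g p)).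
Proof.
move=> cf cg p; apply: (cvg_pair (G := nbhs (f p)) (H := nbhs (g p))).
  exact: cf.
exact: cg.
Qed.

Section MappingClassGroup.
Variables (R : realType) (X : topologicalType) (x0 : X) (z : chain int R X 2).
Local Notation I := (unit_interval R).

(* Homeomorphisms of X fixing x0 and preserving the orientation class of z.   *)
Record homeo := Homeo {
  homeo_map :> continuousType X X;
  homeo_inv : continuousType X X;
  homeoK : cancel homeo_map homeo_inv;
  homeo_invK : cancel homeo_inv homeo_map;
  homeo_base : homeo_map x0 = x0;
  homeo_orient : homologous (pushforward homeo_map z) z }.
HB.instance Definition _ := gen_eqMixin homeo.
HB.instance Definition _ := gen_choiceMixin homeo.

Definition homeo_one : homeo.
Proof.
apply: (@Homeo idfun idfun) => //.
by rewrite pushforward_id; exact: homologous_refl.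
Defined.

Definition homeo_mul (f g : homeo) : homeo.
Proof.
apply: (@Homeo (homeo_map f \o homeo_map g) (homeo_inv g \o homeo_inv f)).
- by move=> x /=; rewrite !homeoK.
- by move=> x /=; rewrite !homeo_invK.
- by rewrite /= !homeo_base.
- rewrite pushforward_comp; apply: homologous_trans (homeo_orient f).
  exact/pushforward_homologous/homeo_orient.
Defined.

Definition homeo_opp (f : homeo) : homeo.
Proof.
apply: (@Homeo (homeo_inv f) (homeo_map f)).
- exact: homeo_invK.
- exact: homeoK.
- by rewrite -[in LHS](homeo_base f) homeoK.
- apply: homologous_sym; rewrite -[X in homologous X _]pushforward_id.
  have -> : idfun = homeo_inv f \o homeo_map f :> continuousType X X.
    by apply/continuousEP => x; rewrite /= homeoK.
  by rewrite pushforward_comp; exact/pushforward_homologous/homeo_orient.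
Defined.

Definition isotopic (f g : homeo) := exists H : continuousType (I * X)%type X,
  [/\ forall t : I, exists h : homeo, forall x, H (t, x) = h x,
      forall (t : I) x, val t = 0 -> H (t, x) = f x &
      forall (t : I) x, val t = 1 -> H (t, x) = g x].

Lemma isotopic_ext (f g : homeo) : f =1 g -> isotopic f g.
Proof.
move=> fg; have cH : continuous (homeo_map f \o @snd I X).
  by move=> p; apply: continuous_comp; [exact: cvg_snd | exact: cts_fun].
exists (mkcts cH); split=> [t|t x _|t x _] //=; first by exists f.
exact: fg.
Qed.

Lemma isotopic_eq (f f' g g' : homeo) :
  f =1 f' -> g =1 g' -> isotopic f g -> isotopic f' g'.
Proof.
move=> ff' gg' [H [Hh H0 H1]]; exists H; split=> // t x t01.
  by rewrite -ff' H0.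
by rewrite -gg' H1.
Qed.

Lemma isotopic_mul (f f' g g' : homeo) :
  isotopic f f' -> isotopic g g' -> isotopic (homeo_mul f g) (homeo_mul f' g').
Proof.
move=> [H [Hh H0 H1]] [K [Kh K0 K1]].
have cL : continuous (H \o (fun p : I * X => (p.1, K p))).
  move=> p; apply: continuous_comp; last exact: cts_fun.
  apply: pair_continuous => q; [exact: cvg_fst | exact: cts_fun].
exists (mkcts cL); split=> [t|t x t0|t x t1].
- have [h hE] := Hh t; have [k kE] := Kh t.
  by exists (homeo_mul h k) => x; rewrite [RHS]/= -kE -hE.
- by rewrite [LHS]/= /mkcts [LHS]/= H0 // K0.
- by rewrite [LHS]/= /mkcts [LHS]/= H1 // K1.
Qed.

Lemma rev_interval_subproof (t : I) : 1 - val t \in I.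
Proof.
have := set_valP t; rewrite /unit_interval /= in_itv /= => /andP[t0 t1].
by apply/mem_set; rewrite /unit_interval /= in_itv /= subr_ge0 t1 gerBl.
Qed.

Definition rev_interval (t : I) : I :=
  exist (fun s => s \in I) _ (rev_interval_subproof t).

Lemma rev_interval_continuous : continuous rev_interval.
Proof.
apply: continuous_comp_initial => t.
apply: (@continuous_comp _ _ _ (val : I -> R) (fun s => 1 - s)).
  exact: initial_continuous.
by apply: cvgB; [exact: cvg_cst | exact: cvg_id].
Qed.

Lemma isotopic_sym (f g : homeo) : isotopic f g -> isotopic g f.
Proof.
move=> [H [Hh H0 H1]].
have cL : continuous (H \o (fun p : I * X => (rev_interval p.1, p.2))).
  move=> p; apply: continuous_comp; last exact: cts_fun.
  apply: pair_continuous => q; last exact: cvg_snd.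
  apply: (@continuous_comp _ _ _ fst rev_interval); first exact: cvg_fst.
  exact: rev_interval_continuous.
exists (mkcts cL); split=> [t|t x t0|t x t1].
- by have [h hE] := Hh (rev_interval t); exists h => x; rewrite -hE.
- by apply: (H1 (rev_interval t)); rewrite /= t0 subr0.
- by apply: (H0 (rev_interval t)); rewrite /= t1 subrr.
Qed.


Lemma isotopic_trans (f g h : homeo) :
  isotopic f g -> isotopic g h -> isotopic f h.
Proof.
move=> fg gh.
have := isotopic_mul gh (isotopic_mul (isotopic_ext (frefl (homeo_opp g))) fg).
by apply: isotopic_eq => x /=; rewrite ?homeoK ?homeo_invK.
Qed.

Lemma isotopic_opp (f g : homeo) :
  isotopic f g -> isotopic (homeo_opp f) (homeo_opp g).
Proof.
move=> /isotopic_sym fg.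
have := isotopic_mul (isotopic_ext (frefl (homeo_opp f)))
  (isotopic_mul fg (isotopic_ext (frefl (homeo_opp g)))).
by apply: isotopic_eq => x /=; rewrite ?homeoK ?homeo_invK.
Qed.

Definition isotopicb (f g : homeo) : bool := `[< isotopic f g >].

Lemma isotopicb_refl : reflexive isotopicb.
Proof. by move=> f; apply/asboolP; exact: isotopic_ext. Qed.

Lemma isotopicb_sym : symmetric isotopicb.
Proof. by move=> f g; apply: asbool_equiv_eq; split; exact: isotopic_sym. Qed.

Lemma isotopicb_trans : transitive isotopicb.
Proof.
by move=> g f h /asboolP fg /asboolP gh; apply/asboolP; exact: isotopic_trans gh.
Qed.

Canonical isotopic_equiv :=
  EquivRel isotopicb isotopicb_refl isotopicb_sym isotopicb_trans.
Canonical isotopic_encModRel := defaultEncModRel isotopicb.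

Definition mcg := {eq_quot isotopicb}.
HB.instance Definition _ := Choice.on mcg.

Definition mcg_class (f : homeo) : mcg := \pi_mcg f.

Definition mcg_mul (a b : mcg) : mcg := mcg_class (homeo_mul (repr a) (repr b)).
Definition mcg_inv (a : mcg) : mcg := mcg_class (homeo_opp (repr a)).

Lemma mcg_classP (f g : homeo) : mcg_class f = mcg_class g <-> isotopic f g.
Proof.
split=> [fg|fg]; last by apply/eqmodP; exact/asboolP.
by apply/asboolP; move/eqmodP: fg.
Qed.

Lemma isotopic_repr (f : homeo) : isotopic (repr (mcg_class f)) f.
Proof. by apply/mcg_classP; rewrite /mcg_class reprK. Qed.

Lemma mcg_classK (a : mcg) : mcg_class (repr a) = a.
Proof. exact: reprK. Qed.

Lemma mcg_mulE (f g : homeo) :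
  mcg_mul (mcg_class f) (mcg_class g) = mcg_class (homeo_mul f g).
Proof. by apply/mcg_classP/isotopic_mul; exact: isotopic_repr. Qed.

Lemma mcg_invE (f : homeo) : mcg_inv (mcg_class f) = mcg_class (homeo_opp f).
Proof. by apply/mcg_classP/isotopic_opp; exact: isotopic_repr. Qed.

Lemma mcg_mulA : associative mcg_mul.
Proof.
move=> a b c; rewrite -[a]mcg_classK -[b]mcg_classK -[c]mcg_classK !mcg_mulE.
by apply/mcg_classP/isotopic_ext.
Qed.

Lemma mcg_mul1 : left_id (mcg_class homeo_one) mcg_mul.
Proof.
by move=> a; rewrite -[a]mcg_classK mcg_mulE; apply/mcg_classP/isotopic_ext.
Qed.

Lemma mcg_mulr1 : right_id (mcg_class homeo_one) mcg_mul.
Proof.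
by move=> a; rewrite -[a]mcg_classK mcg_mulE; apply/mcg_classP/isotopic_ext.
Qed.

Lemma mcg_mulV : left_inverse (mcg_class homeo_one) mcg_inv mcg_mul.
Proof.
move=> a; rewrite -[a]mcg_classK mcg_invE mcg_mulE.
by apply/mcg_classP/isotopic_ext => x /=; rewrite homeoK.
Qed.

Lemma mcg_mulrV : right_inverse (mcg_class homeo_one) mcg_inv mcg_mul.
Proof.
move=> a; rewrite -[a]mcg_classK mcg_invE mcg_mulE.
by apply/mcg_classP/isotopic_ext => x /=; rewrite homeo_invK.
Qed.

HB.instance Definition _ := isGroup.Build mcg
  mcg_mulA mcg_mul1 mcg_mulr1 mcg_mulV mcg_mulrV.

End MappingClassGroup.

Section ClosedSurface.
Variables (R : realType) (X : topologicalType).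

Definition locally_plane := forall x : X,
  exists (U : set X) (f : X -> 'rV[R]_2) (f' : 'rV[R]_2 -> X),
  [/\ open U /\ U x, {within U, continuous f}, continuous f',
      forall y, U y -> f' (f y) = y & forall v, U (f' v) /\ f (f' v) = v].

Definition closed_surface :=
  [/\ hausdorff_space X, compact [set: X], connected [set: X] & locally_plane].

(* H_2(X; Z) is infinite cyclic, generated by the class of z: this is an      *)
(* orientation of the closed surface X.                                       *)
Definition fundamental_cycle (z : chain int R X 2) :=
  is_cycle z /\ forall c : chain int R X 2, is_cycle c ->
    exists! n : int, homologous c (n *: z).

Definition cocycle1 (a : singular_simplex R X 1 -> rat) :=
  forall s : singular_simplex R X 2, \sum_(i < 3) (-1) ^+ i * a (face i s) = 0.

(* [face ord_max s] and [face ord0 s] are the front edge [v0, v1] and the     *)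
(* back edge [v1, v2] of the 2-simplex s.                                     *)
Definition cup_eval (z : chain int R X 2) (a b : singular_simplex R X 1 -> rat) :
    rat :=
  \sum_(s <- freeg.dom z)
     (coeff s z)%:~R * (a (face ord_max s) * b (face ord0 s)).

Definition cap (z : chain int R X 2) (a : singular_simplex R X 1 -> rat) :
    chain rat R X 1 :=
  \sum_(s <- freeg.dom z)
     ((coeff s z)%:~R * a (face ord_max s)) *: << face ord0 s >>.

End ClosedSurface.

Definition symp (g : nat) : 'M[rat]_(g + g) := block_mx 0 1%:M (- 1%:M) 0.

(* An identification of H_1(X; Q) with Q^2g (so X has genus g) which carries  *)
(* the intersection form mu to the standard symplectic form, that is, the     *)
(* choice of a symplectic basis.  By definition mu is dual to the cup product *)
(* under Poincare duality a |-> z \cap a: mu(z \cap a, z \cap b) is the value *)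
(* of a \cup b on z.  The values of h outside of the cycles are irrelevant.   *)
Definition symplectic_marking (R : realType) (X : topologicalType) (g : nat)
    (z : chain int R X 2) (h : {linear chain rat R X 1 -> 'cV[rat]_(g + g)}) :=
  [/\ forall c, is_cycle c -> (h c = 0 <-> is_boundary c),
      forall v, exists2 c, is_cycle c & h c = v &
      forall a b, cocycle1 a -> cocycle1 b ->
        ((h (cap z a))^T *m symp g *m h (cap z b)) 0 0 = cup_eval z a b].

Section Loops.
Variables (R : realType) (X : topologicalType) (x0 : X).

Record loop := Loop {
  loop_fun :> R -> X;
  loop_cont : {within unit_interval R, continuous loop_fun};
  loop_start : loop_fun 0 = x0;
  loop_end : loop_fun 1 = x0 }.

Definition path_cat (f g : R -> X) : R -> X :=
  fun t => if t <= 1 / 2 then f (2 * t) else g (2 * t - 1).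
Definition path_rev (f : R -> X) : R -> X := fun t => f (1 - t).
Definition path_commutator (f g : R -> X) : R -> X :=
  path_cat f (path_cat g (path_cat (path_rev f) (path_rev g))).
Definition commutator_product (s : seq (loop * loop)) : R -> X :=
  foldr (fun (p : loop * loop) f => path_cat (path_commutator p.1 p.2) f) (cst x0) s.

Definition loop_homotopic (f g : R -> X) := exists H : R * R -> X,
  [/\ {within unit_interval R `*` unit_interval R, continuous H},
      forall t, unit_interval R t -> H (0, t) = f t /\ H (1, t) = g t &
      forall s, unit_interval R s -> H (s, 0) = x0 /\ H (s, 1) = x0].

Lemma simplex1_interval (s : simplex R 1) : val s 0 ord_max \in unit_interval R.
Proof.
have /set_mem[s0 s1] := valP s; apply/mem_set; rewrite /unit_interval /= in_itv /=.
rewrite s0 /= -s1 big_ord_recr /= lerDr; apply: sumr_ge0 => i _; exact: s0.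
Qed.

Definition simplex1_coord (s : simplex R 1) : unit_interval R :=
  exist (fun t => t \in unit_interval R) _ (simplex1_interval s).

Lemma simplex1_coord_continuous : continuous simplex1_coord.
Proof.
apply: continuous_comp_initial => s.
apply: (@continuous_comp _ _ _ (val : simplex R 1 -> _)
          (fun v : 'rV[R]_2 => v 0 ord_max)); first exact: initial_continuous.
exact: coord_continuous.
Qed.

Lemma loop_simplex_continuous (f : loop) :
  continuous (sigL (unit_interval R) f \o simplex1_coord).
Proof.
move=> s; apply: continuous_comp; first exact: simplex1_coord_continuous.
by have /subspace_sigL_continuousP cf := @loop_cont f; exact: cf.
Qed.

Definition loop_simplex (f : loop) : singular_simplex R X 1 :=
  mkcts (@loop_simplex_continuous f).

End Loops.

Section Tensors.
Variable g : nat.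

(* The tensor power of Q^2g indexed by P, by coordinates on the basis tensors *)
(* e_(I p1) (x) e_(I p2) (x) ... with I : P -> 'I_2g.                         *)
Definition tensor (P : finType) := {ffun {ffun P -> 'I_(g + g)} -> rat}.

Definition tensor_act (P : finType) (M : 'M[rat]_(g + g)) (t : tensor P) : tensor P :=
  [ffun I : {ffun P -> 'I_(g + g)} =>
     \sum_(K : {ffun P -> 'I_(g + g)}) (\prod_p M (I p) (K p)) * t K].

(* The exterior cube, as the space of alternating tensors of degree 3. *)
Definition alternating (t : tensor 'I_3) :=
  forall (s : 'S_3) (I : {ffun 'I_3 -> 'I_(g + g)}),
    t [ffun i => I (s i)] = (-1) ^+ s * t I.

Definition tensor3 (t : tensor 'I_3) (a b c : 'I_(g + g)) : rat :=
  t [ffun i : 'I_3 => tnth [tuple a; b; c] i].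

(* The antisymmetrization t_1 /\ ... /\ t_N of t_1 (x) ... (x) t_N.           *)
Definition wedge (N : nat) (t : 'I_N -> tensor 'I_3) : tensor ('I_N * 'I_3)%type :=
  [ffun I : {ffun 'I_N * 'I_3 -> 'I_(g + g)} =>
     \sum_(s : 'S_N) (-1) ^+ s * \prod_v t (s v) [ffun j => I (v, j)]].

End Tensors.
Arguments alternating {g} t.

Section Johnson.
Variables (R : realType) (X : topologicalType) (x0 : X) (z : chain int R X 2).
Variables (g : nat) (h : {linear chain rat R X 1 -> 'cV[rat]_(g + g)}).
Local Notation G := (mcg x0 z).

Definition homology_action (rho : G -> 'M[rat]_(g + g)) :=
  forall (f : homeo x0 z) (c : chain rat R X 1), is_cycle c ->
    h (pushforward f c) = rho (mcg_class f) *m h c.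

Definition crossed_hom (rho : G -> 'M[rat]_(g + g)) (kt : G -> tensor g 'I_3) :=
  (forall a, alternating (kt a)) /\
  forall a b, kt (a * b)%g = kt a + tensor_act (rho a) (kt b).

Definition torelli (f : homeo x0 z) :=
  forall c : chain int R X 1, is_cycle c -> homologous (pushforward f c) c.

Definition loop_class (f : loop R x0) : 'cV[rat]_(g + g) := h << loop_simplex f >>.

(* The Johnson homomorphism tau sends a Torelli element f to the element of   *)
(* the exterior cube whose image in Hom(H, /\^2 H / omega) is the map         *)
(* [c] |-> f(c) c^-1, where a product of commutators [x_i, y_i] in pi_1 is    *)
(* sent to the sum of the [x_i] /\ [y_i] in /\^2 H / omega, and an element t  *)
(* of the exterior cube acts on H by contraction with mu.  As g >= 2 this     *)
(* characterizes tau(f).                                                      *)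
Definition extends_johnson (kt : G -> tensor g 'I_3) :=
  forall f : homeo x0 z, torelli f ->
  forall (c : loop R x0) (s : seq (loop R x0 * loop R x0)),
    loop_homotopic x0 (path_cat (f \o c) (path_rev c)) (commutator_product s) ->
  exists r : rat, forall a b : 'I_(g + g),
    \sum_i (symp g *m loop_class c) i 0 * tensor3 (kt (mcg_class f)) i a b =
    \sum_(p <- s) (loop_class p.1 a 0 * loop_class p.2 b 0 -
                   loop_class p.1 b 0 * loop_class p.2 a 0) + r * symp g a b.

End Johnson.

Section GroupCohomology.
Variable G : groupType.

(* Inhomogeneous cochains with coefficients in the trivial module Q. *)
Definition cochain (n : nat) := ('I_n -> G) -> rat.

Definition merge n (i : 'I_n) (x : 'I_n.+1 -> G) : 'I_n -> G := fun j =>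
  if (j < i)%N then x (widen_ord (leqnSn n) j)
  else if j == i then (x (widen_ord (leqnSn n) j) * x (lift ord0 j))%g
  else x (lift ord0 j).

Definition coboundary n (c : cochain n) : cochain n.+1 := fun x =>
  c (fun j => x (lift ord0 j))
  + \sum_(i < n) (-1) ^+ i.+1 * c (merge i x)
  + (-1) ^+ n.+1 * c (fun j => x (widen_ord (leqnSn n) j)).

(* The class of the n-cocycle c vanishes in H^n(G; Q).  For G = mcg x0 z this *)
(* is also what vanishing means in the tautological algebras, which are       *)
(* subalgebras of the cohomology of G: directly in the pointed case, through  *)
(* the injection induced by the forgetful map in the unpointed case.          *)
Definition null_cohomologous n : cochain n -> Prop :=
  match n with
  | 0 => fun c => forall x, c x = 0
  | n'.+1 => fun c => exists b : cochain n', forall x, c x = coboundary b x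
  end.

End GroupCohomology.

Local Close Scope classical_set_scope.
Local Open Scope set_scope.

Section PerfectMatching.
Variable T : finType.

Definition is_matching (m : {ffun T -> T}) :=
  [forall x, (m x != x) && (m (m x) == x)].

Record matching := Matching { mate :> {ffun T -> T}; _ : is_matching mate }.

HB.instance Definition _ := [isSub for mate].
HB.instance Definition _ := [Finite of matching by <:].

Lemma mateK (m : matching) : involutive m.
Proof. by move=> x; have /forallP/(_ x)/andP[_ /eqP] := valP m. Qed.

Lemma mate_neq (m : matching) x : m x != x.
Proof. by have /forallP/(_ x)/andP[] := valP m. Qed.

End PerfectMatching.

Section Transport.
Variables (T T' : finType) (f : T -> T') (f' : T' -> T).
Hypotheses (fK : cancel f f') (f'K : cancel f' f).

Lemma transport_subproof (m : matching T) : is_matching [ffun y => f (m (f' y))].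
Proof.
apply/forallP => y; rewrite !ffunE fK mateK f'K eqxx andbT.
by rewrite -[X in _ != X]f'K (can_eq fK) mate_neq.
Qed.

Definition transport (m : matching T) : matching T' :=
  Matching (transport_subproof m).

End Transport.

Section Surgery.
Variables (T : finType) (m : matching T) (S : pred T) (q : T -> T).
Hypotheses (qK : forall x, S x -> q (q x) = x) (q_neq : forall x, S x -> q x != x).
Hypothesis (qS : forall x, S x -> S (q x)).

(* The map following alternately the edges of m and the pairs {x, q x} inside *)
(* S until it leaves S; #|T| steps always suffice.                            *)
Definition surgery_step x := if S x then m (q x) else x.

Definition surgery_fun : {ffun T -> T} :=
  [ffun x => if S x then q x else iter #|T| surgery_step (m x)].

Let q' x := if S x then q x else x.
Let t x := m (q' x).

Let q'K : involutive q'.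
Proof.
move=> x; rewrite /q'; case: (boolP (S x)) => Sx; last by rewrite (negPf Sx).
by rewrite qS // qK.
Qed.

Let t_inj : injective t.
Proof. exact: inj_comp (inv_inj (mateK m)) (inv_inj q'K). Qed.

Let exitP x : ~~ S x -> exists j, [/\ (j < #|T|)%N,
  forall i, (i < j)%N -> S (iter i t (m x)) & ~~ S (iter j t (m x))].
Proof.
move=> Sx; have tx : t x = m x by rewrite /t /q' (negPf Sx).
have ex : exists j, (j < #|T|)%N && ~~ S (iter j t (m x)).
  exists (fingraph.order t x).-1; rewrite prednK ?fingraph.order_gt0 // max_card /=.
  by rewrite -tx -iterSr prednK ?fingraph.order_gt0 // iter_order.
case: (ex_minnP ex) => j /andP[jT Sj] jmin; exists j; split=> // i ij.
by apply/negPn/negP => Si; have := jmin i; rewrite Si andbT; lia.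
Qed.

Let surgeryE x j : ~~ S x -> (forall i, (i < j)%N -> S (iter i t (m x))) ->
  ~~ S (iter j t (m x)) -> surgery_fun x = iter j t (m x).
Proof.
move=> Sx Sj nSj; have [j' [j'T Sj' nSj']] := exitP Sx.
have ejj : j = j'.
  case: (ltngtP j j') => // [/Sj'|/Sj]; first by rewrite (negPf nSj).
  by rewrite (negPf nSj').
subst j'; rewrite ffunE (negPf Sx).
have itE i : (i <= j)%N -> iter i surgery_step (m x) = iter i t (m x).
  elim: i => //= i IH ij; rewrite IH; last exact: ltnW.
  by rewrite /surgery_step /t /q' !Sj.
rewrite -(subnK (ltnW j'T)) iterD itE //.
elim: (_ - _)%N => //= n ->; by rewrite /surgery_step (negPf nSj).
Qed.

Let reverse x j : ~~ S x -> (forall i, (i < j)%N -> S (iter i t (m x))) ->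
  let y := iter j t (m x) in
  (forall i, (i < j)%N -> iter i t (m y) = q (iter (j - i.+1) t (m x)))
  /\ iter j t (m y) = x.
Proof.
move=> Sx Sj y; have rev i : (i < j)%N ->
    iter i t (m y) = q (iter (j - i.+1) t (m x)).
  elim: i => [|i IH] ij /=.
    rewrite subn1 /y -[in LHS](prednK ij) iterS {1}/t mateK /q' Sj //; lia.
  rewrite IH; last exact: ltnW.
  have -> : (j - i.+1 = (j - i.+2).+1)%N by lia.
  have Sa : S (iter (j - i.+2).+1 t (m x)) by apply: Sj; lia.
  rewrite {1}/t /q' qS // qK // iterS {1}/t mateK /q' Sj //; lia.
split=> //; case: j => [|j] in Sj y rev *; first by rewrite /y /= mateK.
rewrite iterS rev // subnn /=.
by have S0 := Sj 0%N isT; rewrite {1}/t /q' qS // qK // mateK.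
Qed.

Lemma surgery_subproof : is_matching surgery_fun.
Proof.
apply/forallP => x; case: (boolP (S x)) => Sx.
  by rewrite !ffunE Sx qS // qK // eqxx andbT q_neq.
have [j [jT Sj nSj]] := exitP Sx; have [rev revj] := reverse Sx Sj.
rewrite (surgeryE Sx Sj nSj); set y := iter j t (m x) in nSj rev revj *.
have Sy i : (i < j)%N -> S (iter i t (m y)).
  by move=> ij; rewrite rev // qS // Sj //; lia.
have -> : surgery_fun y = x by rewrite (surgeryE nSj Sy) revj.
rewrite eqxx andbT; apply/eqP => yx.
have key i : (i < j)%N -> iter i t (m x) = q (iter (j - i.+1) t (m x)).
  by move=> ij; rewrite -rev // yx.
case: (posnP j) => [j0|j0].
  by have := mate_neq m x; rewrite -{2}yx /y j0 eqxx.
have [a ja] : exists a, j = a.*2.+1 \/ j = a.*2.+2.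
  by exists j.-1./2; move: (odd_double_half j.-1); case: odd => /=; lia.
case: ja => ja.
  have Sa : S (iter a t (m x)) by apply: Sj; lia.
  have := key a; have -> : (j - a.+1 = a)%N by lia.
  by move=> /(_ ltac:(lia)) /eqP; rewrite eq_sym (negPf (q_neq Sa)).
have Sa : S (iter a t (m x)) by apply: Sj; lia.
have := key a.+1; have -> : (j - a.+2 = a)%N by lia.
move=> /(_ ltac:(lia)) /eqP; rewrite iterS {1}/t /q' Sa.
by rewrite (negPf (mate_neq m _)).
Qed.

Definition surgery : matching T := Matching surgery_subproof.

End Surgery.

Section ChordDiagrams.

(* A linear chord diagram on n points, that is a partition of the points into *)
(* pairs, is encoded by the fixed-point-free involution swapping each pair.   *)
Definition chord_diagram (n : nat) := matching 'I_n.
HB.instance Definition _ n := Finite.on (chord_diagram n).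

Variable n : nat.
Implicit Types (C : chord_diagram n) (s : 'S_n).

(* The word (i_1, j_1, i_2, j_2, ...) with i_1 < i_2 < ... and i_s < j_s. *)
Definition chord_word C : seq 'I_n :=
  flatten [seq [:: i; C i] | i <- [seq i : 'I_n <- enum 'I_n | (i < C i)%N]].

(* The word is a permutation, so the default value of insubd is not used. *)
Definition chord_perm C : 'S_n :=
  insubd (1%g : 'S_n) [ffun m : 'I_n => nth m (chord_word C) m].

Definition relabel s C : chord_diagram n := transport (permK s) (permKV s) C.

Definition QD := {ffun chord_diagram n -> rat^o}.
HB.instance Definition _ := Vector.on QD.

Definition QD_act s (xi : QD) : QD := [ffun C => xi (relabel s^-1 C)].

End ChordDiagrams.

Section YoungModules.
Variable n : nat.

Definition QS := {ffun 'S_n -> rat^o}.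
HB.instance Definition _ := Vector.on QS.

(* Left translation by s on the group algebra; in MathComp the composition    *)
(* s \o t of permutations is written (t * s)%g.                               *)
Definition QS_act (s : 'S_n) (x : QS) : QS := [ffun u => x (u * s^-1)%g].

(* The Young symmetrizer (sum of p) (sum of sgn(q) q), p and q ranging over   *)
(* the row and the column group of the tableau of shape sh with boxes         *)
(* numbered 0, ..., n-1 in reading order.                                     *)
Definition row_group (sh : seq nat) (p : 'S_n) :=
  [forall i, reshape_index sh (p i) == reshape_index sh i].
Definition column_group (sh : seq nat) (q : 'S_n) :=
  [forall i, reshape_offset sh (q i) == reshape_offset sh i].

Definition young_symmetrizer (sh : seq nat) : QS :=
  [ffun u => \sum_(p | row_group sh p) \sum_(q | column_group sh q)
               (-1) ^+ (q : 'S_n) * (u == q * p)%g%:R].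

Definition young_module (sh : seq nat) : {vspace QS} :=
  <<[seq QS_act s (young_symmetrizer sh) | s : 'S_n]>>%VS.

End YoungModules.

Definition young_diagram (n : nat) (la : seq nat) :=
  [&& sorted geq la, all (ltn 0) la & sumn la == n].

(* E is a submodule of Q D(n) isomorphic to the irreducible representation    *)
(* with Young diagram 2 la; as Q D(n) is multiplicity free, E is E_la.        *)
Definition is_E (n : nat) (la : seq nat) (E : {vspace QD n}) :=
  (forall s xi, xi \in E -> QD_act s xi \in E) /\
  exists f : 'Hom(QS n, QD n), let V := young_module n [seq l.*2 | l <- la] in
  [/\ forall s x, x \in V -> f (QS_act s x) = QD_act s (f x),
      (lker f :&: V = 0)%VS & (f @: V = E)%VS].

Section TrivalentGraphs.
Variable N : nat.

(* A trivalent graph with vertex set 'I_N: the half-edges at v are the pairs  *)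
(* (v, j), and the edges are given by a perfect matching of the half-edges.   *)
Definition tgraph := matching ('I_N * 'I_3)%type.
HB.instance Definition _ := Finite.on tgraph.

(* s maps half-edges at one vertex to half-edges at one vertex, edges to edges. *)
Definition iso_fun (Ga Ga' : tgraph) (s : {perm 'I_N * 'I_3}) :=
  [forall x, forall y, ((s x).1 == (s y).1) == (x.1 == y.1)]
  && [forall x, s (Ga x) == Ga' (s x)].

Definition tgraph_iso (Ga Ga' : tgraph) := [exists s, iso_fun Ga Ga' s].

Lemma tgraph_iso_refl : reflexive tgraph_iso.
Proof.
move=> Ga; apply/existsP; exists 1%g; apply/andP; split; apply/forallP => x.
  by apply/forallP => y; rewrite !perm1.
by rewrite !perm1.
Qed.

Lemma tgraph_iso_inv Ga Ga' : tgraph_iso Ga Ga' -> tgraph_iso Ga' Ga.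
Proof.
move=> /existsP[s /andP[/forallP s1 /forallP s2]]; apply/existsP; exists s^-1%g.
apply/andP; split; apply/forallP => x.
  by apply/forallP => y; have /forallP/(_ (s^-1%g y)) := s1 (s^-1%g x);
     rewrite !permKV eq_sym.
by rewrite -(inj_eq (@perm_inj _ s)) permKV (eqP (s2 _)) permKV.
Qed.

Lemma tgraph_iso_sym : symmetric tgraph_iso.
Proof. by move=> Ga Ga'; apply/idP/idP; exact: tgraph_iso_inv. Qed.

Lemma tgraph_iso_trans : transitive tgraph_iso.
Proof.
move=> Ga' Ga Ga'' /existsP[s /andP[/forallP s1 /forallP s2]].
move=> /existsP[t /andP[/forallP t1 /forallP t2]]; apply/existsP; exists (s * t)%g.
apply/andP; split; apply/forallP => x.
  apply/forallP => y; rewrite !permM.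
  by rewrite (eqP (forallP (t1 _) _)) (eqP (forallP (s1 _) _)).
by rewrite !permM (eqP (s2 _)) (eqP (t2 _)).
Qed.

Canonical tgraph_iso_equiv :=
  EquivRel tgraph_iso tgraph_iso_refl tgraph_iso_sym tgraph_iso_trans.
Canonical tgraph_iso_encModRel := defaultEncModRel tgraph_iso.

Definition tgraph_class := {eq_quot tgraph_iso}.
HB.instance Definition _ := Choice.on tgraph_class.

Definition class_of (Ga : tgraph) : tgraph_class := \pi_tgraph_class Ga.

(* The degree N part of Q[Gamma; Gamma in G]: its monomials are the           *)
(* isomorphism classes of possibly disconnected trivalent graphs.             *)
Definition graph_space := {freeg tgraph_class / rat}.
HB.instance Definition _ := GRing.Lmodule.on graph_space.

Definition half_edge_pair := {B : {set 'I_3} | #|B| == 2}.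

Definition other (B : half_edge_pair) (i : 'I_3) : 'I_3 :=
  odflt i [pick j in val B :\ i].

Lemma otherP (B : half_edge_pair) i : i \in val B ->
  [/\ other B i \in val B, other B i != i & other B (other B i) = i].
Proof.
have D j : j \in val B -> exists l, val B :\ j = [set l].
  move=> jB; apply/cards1P/eqP/succn_inj.
  by rewrite -[RHS](eqP (valP B)) (cardsD1 j (val B)) (jB : (j \in val B) = true).
have pick1 j l : val B :\ j = [set l] -> other B j = l.
  rewrite /other => ->; case: pickP => [l'|/(_ l)]; last by rewrite set11.
  by rewrite inE => /eqP->.
move=> iB; have [j jD] := D i iB; have jE := pick1 _ _ jD.
have : j \in val B :\ i by rewrite jD set11.
rewrite in_setD1 => /andP[ji jB]; rewrite jE; split=> //.
have [l lD] := D j jB; rewrite (pick1 _ _ lD); apply/esym/set1P.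
by rewrite -lD in_setD1 eq_sym ji.
Qed.

Definition choices_at (F : {set 'I_N}) (w : {ffun 'I_N -> option half_edge_pair}) :=
  [forall v, (v \in F) == w v].

Section Contraction.
Variables (Ga : tgraph) (w : {ffun 'I_N -> option half_edge_pair}).

Definition chosen (x : 'I_N * 'I_3) :=
  if w x.1 is Some B then x.2 \in val B else false.

Definition partner (x : 'I_N * 'I_3) :=
  if w x.1 is Some B then (x.1, other B x.2) else x.

Lemma partnerP x : chosen x -> [/\ chosen (partner x), partner x != x &
  partner (partner x) = x].
Proof.
case: x => v i; rewrite /chosen /partner /=; case wv: (w v) => [B|] //= iB.
have [jB ji jK] := otherP iB; rewrite wv jB jK; split=> //.
by rewrite xpair_eqE eqxx.
Qed.

Lemma partnerK x : chosen x -> partner (partner x) = x.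
Proof. by move=> /partnerP[]. Qed.

Lemma partner_neq x : chosen x -> partner x != x.
Proof. by move=> /partnerP[]. Qed.

Lemma chosen_partner x : chosen x -> chosen (partner x).
Proof. by move=> /partnerP[]. Qed.

Definition contract : tgraph := surgery Ga partnerK partner_neq chosen_partner.

(* The discarded circles are the connected components, inside the set of      *)
(* chosen half-edges, for the relation generated by the edges and the pairs.  *)
Definition circle_rel : rel ('I_N * 'I_3) := fun x y =>
  (y == Ga x) || chosen x && (y == partner x).

Definition circles : {set {set 'I_N * 'I_3}} :=
  [set B in [set [set y | connect circle_rel x y] | x : 'I_N * 'I_3]
     | B \subset chosen].

End Contraction.

Definition contraction_graph (g p : nat) (Ga : tgraph) : graph_space :=
  ((2 * g)%:R - 2) ^- p *:
  \sum_(F : {set 'I_N} | #|F| == p)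
   \sum_(w : {ffun 'I_N -> option half_edge_pair} | choices_at F w)
     ((-1) ^+ p * (- (2 * g)%:R) ^+ #|circles Ga w|) *: << class_of (contract Ga w) >>.

(* contraction_graph only depends on the isomorphism class of the graph. *)
Definition contraction (g p : nat) (x : graph_space) : graph_space :=
  fglift (fun cl : tgraph_class => contraction_graph g p (repr cl)) x.

Definition graph_bar (g : nat) (x : graph_space) : graph_space :=
  \sum_(p < N.+1) (-1) ^+ p *: contraction g p x.

End TrivalentGraphs.

Section GraphOfChordDiagram.
Variable k : nat.

Lemma point_half_edge_subproof (i : 'I_(6 * k)) : (i %/ 3 < 2 * k)%N.
Proof. by have := ltn_ord i; lia. Qed.

Lemma half_edge_point_subproof (x : 'I_(2 * k) * 'I_3) : (x.1 * 3 + x.2 < 6 * k)%N.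
Proof. by have := ltn_ord x.1; have := ltn_ord x.2; lia. Qed.

Definition point_half_edge (i : 'I_(6 * k)) : 'I_(2 * k) * 'I_3 :=
  (Ordinal (point_half_edge_subproof i), inord (i %% 3)).

Definition half_edge_point (x : 'I_(2 * k) * 'I_3) : 'I_(6 * k) :=
  Ordinal (half_edge_point_subproof x).

Lemma point_half_edgeK : cancel point_half_edge half_edge_point.
Proof.
by move=> i; apply/val_inj; rewrite /= inordK ?ltn_mod // -divn_eq.
Qed.

Lemma half_edge_pointK : cancel half_edge_point point_half_edge.
Proof.
move=> [v j]; congr pair; apply/val_inj => /=; have := ltn_ord j; first lia.
by rewrite inordK ?ltn_mod //; lia.
Qed.

Definition graph_of_chords : chord_diagram (6 * k) -> tgraph (2 * k) :=
  transport point_half_edgeK half_edge_pointK.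

Definition chords_of_graph : tgraph (2 * k) -> chord_diagram (6 * k) :=
  transport half_edge_pointK point_half_edgeK.

Lemma chords_of_graphK : cancel chords_of_graph graph_of_chords.
Proof.
by move=> Ga; apply/val_inj/ffunP => x; rewrite !ffunE !half_edge_pointK.
Qed.

Definition graph_of_xi (xi : QD (6 * k)) : graph_space (2 * k) :=
  \sum_C xi C *: << class_of (graph_of_chords C) >>.

End GraphOfChordDiagram.

Section Alpha.
Variables (g k : nat) (G : groupType).
Variables (rho : G -> 'M[rat]_(g + g)) (kt : G -> tensor g 'I_3).

Definition alpha_form (n : nat) (C : chord_diagram n) (t : tensor g 'I_n) : rat :=
  (-1) ^+ chord_perm C *
  \sum_(I : {ffun 'I_n -> 'I_(g + g)})
     t I * \prod_(i : 'I_n | (i < C i)%N) symp g (I i) (I (C i)).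

(* The cup power of the class of kt, as the cocycle                           *)
(* (x_1, ..., x_N) |-> kt(x_1) /\ x_1 kt(x_2) /\ x_1 x_2 kt(x_3) /\ ...       *)
Definition cup_power (N : nat) (x : 'I_N -> G) : tensor g ('I_N * 'I_3)%type :=
  wedge (fun v => tensor_act (rho (\big[*%g/1%g]_(u < N | (u < v)%N) x u)) (kt (x v))).

(* By the antisymmetry of cup_power x and of kt, this depends only on the     *)
(* isomorphism class of Ga, so that repr may be used in alpha.                *)
Definition alpha_graph (Ga : tgraph (2 * k)) : cochain G (2 * k) := fun x =>
  alpha_form (chords_of_graph Ga)
    [ffun I : {ffun 'I_(6 * k) -> 'I_(g + g)} =>
       cup_power x [ffun y => I (half_edge_point y)]].

Definition alpha (y : graph_space (2 * k)) : cochain G (2 * k) := fun x =>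
  fglift (fun cl : tgraph_class (2 * k) => alpha_graph (repr cl) x : rat^o) y.

End Alpha.

(* Main.v *)
(** All the classes vanish already as cochains. The coefficient of [alpha_C] at
    a basis tensor is [sgn C] times a product of entries of the symplectic form,
    one for each chord, so that relabelling [C] by [s] amounts to permuting the
    slots of the tensor by [s], up to [sgn s]. The image in [E] of the Young
    symmetrizer is invariant under the row group, hence its form is antisymmetric
    in the [2 * lambda_1 > 2 * g] slots of the first row and vanishes; therefore
    the form attached to any element of [E] is zero.

    Cutting a graph at a vertex corresponds to contracting two slots of the tensor
    with the symplectic form and inserting the form there: at each vertex this
    gives a factor [-1], and [-2g] for each circle that is split off. The operator
    on tensors does not depend on the graph, so the graphical contraction carries
    the vanishing of the form to that of [alpha]. *)

Require Import Defs.
From HB Require Import structures.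
From mathcomp Require Import freeg.
From mathcomp Require Import all_boot all_order all_algebra all_fingroup.
From mathcomp Require Import generic_quotient zify ring.
From mathcomp Require Import boolp reals topology.

Set Implicit Arguments.
Unset Strict Implicit.
Unset Printing Implicit Defensive.

Import Order.TTheory GRing.Theory Num.Theory.

Local Open Scope ring_scope.

(** * Signs of block-preserving permutations *)

(** A permutation is a product of transpositions, each of which is sent to parity [b]; the parities
    add up along the product. *)
Lemma odd_perm_morph (T T' : finType) (phi : {perm T} -> {perm T'}) (b : bool) :
    {morph phi : s t / (s * t)%g} ->
    (forall x y, x != y -> odd_perm (phi (tperm x y)) = b) ->
  forall s, odd_perm (phi s) = b && odd_perm s.
Proof.
move=> phiM phit s; have phi1 : phi 1%g = 1%g.
  by apply: (mulgI (phi 1%g)); rewrite -phiM !mulg1.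
have [ts -> /=] := prod_tpermP s; elim: ts => [|[x y] ts IH] /=.
  by rewrite big_nil phi1 !odd_perm1 andbF.
case/andP=> xy /IH {}IH; rewrite big_cons phiM !odd_permM IH /= phit //.
by rewrite odd_tperm; rewrite /dpair /= in xy; rewrite xy; case: b {phit IH} => //.
Qed.

(** Conjugation by a bijection is a morphism that sends transpositions to transpositions, even
    between different types. *)
Lemma odd_perm_conj (T T' : finType) (f : T -> T') (f' : T' -> T)
    (s : {perm T}) (s' : {perm T'}) :
  cancel f f' -> cancel f' f -> (forall x, s' (f x) = f (s x)) ->
  odd_perm s' = odd_perm s.
Proof.
move=> fK f'K ss'.
have inj (u : {perm T}) : injective (fun y => f (u (f' y))).
  exact: (inj_comp (can_inj fK) (inj_comp perm_inj (can_inj f'K))).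
have -> : s' = perm (inj s) by apply/permP => y; rewrite permE -{1}[y]f'K ss'.
apply: (@odd_perm_morph T T' (fun u => perm (inj u)) true) => [u v|x y xy].
  by apply/permP => y; rewrite !(permM, permE) fK.
have -> : perm (inj (tperm x y)) = tperm (f x) (f y).
  apply/permP => z; rewrite permE -[in RHS](f'K z).
  by rewrite (inj_tperm _ _ _ (can_inj fK)).
by rewrite odd_tperm (can_eq fK) xy.
Qed.

Section BlockAntisymmetry.
Variables (A B : finType) (b0 : B).

Definition fiber_fun (a : A) (u : {perm B}) (x : A * B) : A * B :=
  if x.1 == a then (a, u x.2) else x.

Lemma fiber_inj a u : injective (fiber_fun a u).
Proof.
apply: (can_inj (g := fiber_fun a u^-1%g)) => -[a' b]; rewrite /fiber_fun /=.
by have [->|/negPf ne] := eqVneq a' a; rewrite /= ?eqxx ?permK ?ne.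
Qed.

Definition fiber_perm a u := perm (@fiber_inj a u).

Lemma odd_fiber_perm a u : odd_perm (fiber_perm a u) = odd_perm u.
Proof.
apply: (@odd_perm_morph _ _ (fiber_perm a) true) => [s t|x y xy].
  apply/permP => -[a' b]; rewrite permM !permE /fiber_fun /=.
  have [e|/negPf ne] := eqVneq a' a; first by rewrite /= eqxx permM.
  by rewrite /= ne.
have -> : fiber_perm a (tperm x y) = tperm (a, x) (a, y).
  apply/permP => -[a' b]; rewrite !permE /fiber_fun /= !xpair_eqE.
  have [->|/negPf ne] := eqVneq a' a; rewrite ?ne ?eqxx //= permE /=.
  by case: (b == x) => //; case: (b == y).
by rewrite odd_tperm xpair_eqE eqxx.
Qed.

Lemma base_inj (s : {perm A}) : injective (fun x : A * B => (s x.1, x.2)).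
Proof. by move=> [a b] [a' b'] [/perm_inj -> ->]. Qed.

Definition base_perm s := perm (@base_inj s).

(** Exchanging two blocks is a product of [#|B|] transpositions, one for each element of a block. *)
Lemma odd_base_perm s : odd_perm (base_perm s) = odd #|B| && odd_perm s.
Proof.
apply: odd_perm_morph => [t u|x y xy].
  by apply/permP => a; rewrite permM !permE.
pose pr (r : seq B) := (\prod_(j <- r) tperm (x, j) (y, j))%g.
have prE r : uniq r -> forall a j,
    pr r (a, j) = if j \in r then (tperm x y a, j) else (a, j).
  elim: r => [|i r IH] /= => [_ a j|/andP[ir /IH{}IH] a j].
    by rewrite /pr big_nil perm1.
  rewrite /pr big_cons permM -/(pr r) inE; have [->|ij] := eqVneq j i.
    have -> : tperm (x, i) (y, i) (a, i) = (tperm x y a, i).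
      case: (tpermP x y a) => [->|->|/eqP xa /eqP ya]; rewrite ?tpermL ?tpermR //.
      by rewrite tpermD // xpair_eqE eqxx andbT eq_sym.
    by rewrite IH (negPf ir).
  by rewrite tpermD ?IH // xpair_eqE (eq_sym i) (negPf ij) andbF.
have -> : base_perm (tperm x y) = pr (enum B).
  by apply/permP => -[a j]; rewrite prE ?enum_uniq // mem_enum permE.
rewrite /pr.
rewrite -(big_map (fun j => ((x, j), (y, j))) xpredT (fun t => tperm t.1 t.2)).
rewrite odd_perm_prod; first by rewrite size_map -cardE.
by apply/allP => t /mapP[j _ ->]; rewrite /dpair /= xpair_eqE negb_and xy.
Qed.

(** To be applied twice: to the product over chords, where blocks have two elements, and to the
    antisymmetrized tensor [wedge], where they have three. The sign in [W_base] is that of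
    [base_perm s]. *)
Variables (D : Type) (W : (A * B -> D) -> rat).
Hypothesis W_fiber : forall a (u : {perm B}) c,
  W (fun x => c (fiber_fun a u x)) = (-1) ^+ u * W c.
Hypothesis W_base : forall (s : {perm A}) c,
  W (fun x => c (s x.1, x.2)) = (-1) ^+ (odd #|B| && s) * W c.

Let good (s : {perm A * B}) := forall c, W (fun x => c (s x)) = (-1) ^+ s * W c.

Let good_mul s t : good s -> good t -> good (s * t)%g.
Proof.
move=> gs gt c; have -> : (fun x => c ((s * t)%g x)) = (fun x => c (t (s x))).
  by apply: funext => x; rewrite permM.
by rewrite (gs (fun x => c (t x))) gt mulrA -signr_addb odd_permM.
Qed.

Let good_fiber a u : good (fiber_perm a u).
Proof.
move=> c; rewrite odd_fiber_perm -(W_fiber a); congr W.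
by apply: funext => x; rewrite permE.
Qed.

Let good_base s : good (base_perm s).
Proof.
by move=> c; rewrite odd_base_perm -W_base; congr W; apply: funext => x; rewrite permE.
Qed.

Let good1 : good 1.
Proof.
by move=> c; rewrite odd_perm1 mul1r; congr W; apply: funext => x; rewrite perm1.
Qed.

(** Induction over a list of blocks outside of which the permutation is trivial: the action on one
    block is split off as a [fiber_perm]. *)
Let good_fixed (s : {perm A * B}) : (forall x, (s x).1 = x.1) -> good s.
Proof.
move=> s1; suff: forall (r : seq A) (t : {perm A * B}), (forall x, (t x).1 = x.1) ->
    (forall x, x.1 \notin r -> t x = x) -> good t.
  by move=> /(_ (enum A) s); apply=> // x; rewrite mem_enum.
elim=> [|a r IH] t t1 tr.
  have -> : t = 1%g by apply/permP => x; rewrite perm1 tr.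
  exact: good1.
have u_inj : injective (fun b => (t (a, b)).2).
  move=> b b' e; have : t (a, b) = t (a, b').
    by rewrite [LHS]surjective_pairing [RHS]surjective_pairing e !t1.
  by move/perm_inj => -[].
have v_inj : injective (fun x => if x.1 == a then x else t x).
  move=> x y; case: eqP => xa; case: eqP => ya //; last exact: perm_inj.
    by move=> e; case: ya; rewrite -t1 -e.
  by move=> e; case: xa; rewrite -t1 e.
have -> : t = (fiber_perm a (perm u_inj) * perm v_inj)%g.
  apply/permP => -[a' b]; rewrite permM !permE /fiber_fun /=.
  have [->|/negPf ne] := eqVneq a' a; last by rewrite /= ne.
  by rewrite /= eqxx permE [LHS]surjective_pairing t1.
apply: good_mul => //; apply: IH => x; rewrite permE; case: eqP => // xa.
by move=> xr; apply: tr; rewrite inE negb_or xr andbT; apply/eqP.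
Qed.

(* Such a permutation permutes inside the blocks and then permutes the blocks; *)
(* the latter step has sign sgn ^ #|B|.                                        *)
Lemma block_antisymmetry (s : {perm A * B}) (c : A * B -> D) :
    (forall x y, ((s x).1 == (s y).1) = (x.1 == y.1)) ->
  W (fun x => c (s x)) = (-1) ^+ s * W c.
Proof.
move=> s1; have u_inj : injective (fun a => (s (a, b0)).1).
  by move=> a a' /eqP; rewrite s1 => /eqP.
have v_inj : injective (fun x => (x.1, (s x).2)).
  move=> x y [xy e]; apply: (@perm_inj _ s).
  rewrite [LHS]surjective_pairing [RHS]surjective_pairing e; congr pair.
  by apply/eqP; rewrite s1 xy.
have -> : s = (perm v_inj * base_perm (perm u_inj))%g.
  apply/permP => x; rewrite permM !permE /=.
  rewrite [LHS]surjective_pairing; congr pair.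
  by apply/eqP; rewrite s1.
by apply: good_mul => //; apply: good_fixed => x; rewrite permE.
Qed.

End BlockAntisymmetry.

(** * The word of a chord diagram *)

Section PairWord.
Variables (T : eqType) (h : T -> T).

Lemma perm_flatten_pairs (L : seq T) :
  perm_eq (flatten [seq [:: i; h i] | i <- L]) (L ++ [seq h i | i <- L]).
Proof.
elim: L => //= i L IH; rewrite perm_cons.
rewrite (perm_trans _ (_ : perm_eq (h i :: (L ++ map h L)) _)) ?perm_cons //.
by rewrite -cat1s -[in X in perm_eq _ X]cat1s perm_catCA.
Qed.

Lemma nth_flatten_pairs x0 (L : seq T) r : (r < size L)%N ->
  nth x0 (flatten [seq [:: i; h i] | i <- L]) (r * 2) = nth x0 L r /\
  nth x0 (flatten [seq [:: i; h i] | i <- L]) (r * 2 + 1) = h (nth x0 L r).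
Proof. by elim: L r => //= i L IH [|r] // /IH[]. Qed.

End PairWord.

Section ChordWord.
Variables (n M : nat) (nM : n = (M * 2)%N) (C : chord_diagram n).

Lemma pair_point_subproof (x : 'I_M * 'I_2) : (x.1 * 2 + x.2 < n)%N.
Proof. by have := ltn_ord x.1; have := ltn_ord x.2; lia. Qed.

Definition pair_point (x : 'I_M * 'I_2) : 'I_n := Ordinal (pair_point_subproof x).

Lemma point_pair_subproof (i : 'I_n) : (i %/ 2 < M)%N.
Proof. by have := ltn_ord i; lia. Qed.

Definition point_pair (i : 'I_n) : 'I_M * 'I_2 :=
  (Ordinal (point_pair_subproof i), inord (i %% 2)).

Lemma pair_pointK : cancel pair_point point_pair.
Proof.
move=> [r j]; congr pair; apply/val_inj => /=; have := ltn_ord j; first lia.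
by rewrite inordK ?ltn_mod //; lia.
Qed.

Lemma point_pairK : cancel point_pair pair_point.
Proof. by move=> i; apply/val_inj; rewrite /= inordK ?ltn_mod // -divn_eq. Qed.

Let L := [seq i : 'I_n <- enum 'I_n | (i < C i)%N].

(** Each point is either the left end of its chord or the mate of a left end, and never both. *)
Let perm_word : perm_eq (chord_word C) (enum 'I_n).
Proof.
apply: perm_trans (perm_flatten_pairs C L) _.
have CL : [seq C i | i <- L] =i [seq i : 'I_n <- enum 'I_n | (C i < i)%N].
  move=> i; rewrite mem_filter mem_enum andbT; apply/mapP/idP => [[j]|Ci].
    by rewrite mem_filter => /andP[ji _] ->; rewrite mateK.
  by exists (C i); rewrite ?mateK // mem_filter mem_enum mateK andbT.
have uE : uniq (enum 'I_n) by exact: enum_uniq.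
apply: uniq_perm => [||i]; rewrite // ?mem_cat ?CL.
  have uL : uniq L by exact: filter_uniq.
  rewrite cat_uniq (map_inj_uniq (inv_inj (mateK C))) uL andbT.
  apply/hasPn => i; rewrite CL mem_filter => /andP[Ci _].
  by apply/negP => /=; rewrite mem_filter => /andP[iC _]; lia.
rewrite mem_enum /L mem_filter mem_enum mem_filter mem_enum !andbT -neq_ltn.
by apply/eqP => /val_inj iC; have := mate_neq C i; rewrite -iC eqxx.
Qed.

Let size_openers : size L = M.
Proof.
have e : perm_eq (chord_word C) (L ++ [seq C i | i <- L]) := perm_flatten_pairs C L.
move: (perm_size perm_word) (perm_size e).
rewrite size_enum_ord size_cat size_map => -> nL; apply/eqP.
by rewrite -(eqn_pmul2r (isT : 0 < 2)%N) muln2 -addnn -nL -nM.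
Qed.

(** Since the word has no repetition, the injectivity test behind [insubd] succeeds and the default
    permutation is never taken. *)
Lemma chord_permE (i : 'I_n) : chord_perm C i = nth i (chord_word C) i.
Proof.
rewrite /chord_perm -pvalE val_insubd /=.
case: ifP => [_|/injectiveP[]]; first by rewrite ffunE.
move=> i1 i2; rewrite !ffunE (set_nth_default i1 i2); last first.
  by rewrite (perm_size perm_word) size_enum_ord.
move/eqP; rewrite nth_uniq ?(perm_size perm_word) ?size_enum_ord //.
  by move/eqP/val_inj.
by rewrite (perm_uniq perm_word) enum_uniq.
Qed.

(** The word read in pairs: [x.1] numbers the chords by increasing left end and [x.2] selects the
    end. *)
Definition chord_point (x : 'I_M * 'I_2) : 'I_n := chord_perm C (pair_point x).

Let chord_point0 (i0 : 'I_n) r : chord_point (r, ord0) = nth i0 L r.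
Proof.
rewrite /chord_point chord_permE (set_nth_default i0); last first.
  by rewrite (perm_size perm_word) size_enum_ord.
have rL : (r < size L)%N by rewrite size_openers.
by have [<- _] := nth_flatten_pairs C i0 rL; rewrite /= addn0.
Qed.

Lemma mate_chord_point r : C (chord_point (r, ord0)) = chord_point (r, ord_max).
Proof.
set i0 := pair_point (r, ord0); rewrite (chord_point0 i0) /chord_point.
rewrite chord_permE (set_nth_default i0); last first.
  by rewrite (perm_size perm_word) size_enum_ord.
have rL : (r < size L)%N by rewrite size_openers.
by have [_ <-] := nth_flatten_pairs C i0 rL.
Qed.

Lemma prod_chords (F : 'I_n -> rat) :
  \prod_(i : 'I_n | (i < C i)%N) F i = \prod_r F (chord_point (r, ord0)).
Proof.
rewrite -(big_enum_cond _ _ xpredT) -big_filter -/L.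
(* Without chords there is no point to serve as default value for [nth]. *)
have [M0|M_gt0] := posnP M.
  rewrite [in RHS]big1 => [|[r rM]]; last by exfalso; rewrite M0 in rM.
  by have /size0nil-> : size L = 0%N; rewrite ?size_openers // big_nil.
set i0 := pair_point (Ordinal M_gt0, ord0).
rewrite (big_nth i0) size_openers big_mkord.
by apply: eq_bigr => r _; rewrite (chord_point0 i0).
Qed.

End ChordWord.

(** * The form of a matching *)

Section PairForm.
Variables (M : nat) (D : Type) (J : D -> D -> rat).
Hypothesis JN : forall i j, J i j = - J j i.

Definition pair_form (c : 'I_M * 'I_2 -> D) : rat :=
  \prod_r J (c (r, ord0)) (c (r, ord_max)).

Lemma perm2P (u : 'S_2) :
  (u ord0 = ord0 /\ u ord_max = ord_max /\ ~~ odd_perm u) \/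
  (u ord0 = ord_max /\ u ord_max = ord0 /\ odd_perm u).
Proof.
have I2 (i : 'I_2) : i = ord0 \/ i = ord_max.
  by case: i => -[|[|]] // i2; [left|right]; apply/val_inj.
have [u0|u0] := I2 (u ord0); have [u1|u1] := I2 (u ord_max).
- by have := perm_inj (etrans u0 (esym u1)).
- left; do 2!split => //; have -> : u = 1%g; last by rewrite odd_perm1.
  by apply/permP => i; rewrite perm1; have [->|->] := I2 i.
- right; do 2!split => //; have -> : u = tperm ord0 ord_max.
    by apply/permP => i; have [->|->] := I2 i; rewrite ?tpermL ?tpermR.
  by rewrite odd_tperm.
- by have := perm_inj (etrans u0 (esym u1)).
Qed.

(** Exchanging the ends of a chord costs a sign by [JN]; permuting the chords costs none, as blocks
    of two points move by even permutations. *)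
Lemma pair_form_antisymmetry (s : {perm 'I_M * 'I_2}) (c : 'I_M * 'I_2 -> D) :
    (forall x y, ((s x).1 == (s y).1) = (x.1 == y.1)) ->
  pair_form (fun x => c (s x)) = (-1) ^+ s * pair_form c.
Proof.
apply: block_antisymmetry => [|a u {}c|t {}c]; first exact: ord0; last first.
  rewrite card_ord mul1r /pair_form [RHS](reindex_inj (@perm_inj _ t)).
  exact: eq_bigr.
rewrite /pair_form (bigD1 a) // [in RHS](bigD1 a) //= mulrA; congr (_ * _).
  rewrite /fiber_fun /= eqxx.
  case: (perm2P u) => [[-> [-> /negPf->]]|[-> [-> ->]]]; first by rewrite mul1r.
  by rewrite mulN1r -JN.
by apply: eq_bigr => r /negPf ra; rewrite /fiber_fun /= ra.
Qed.

End PairForm.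

Section Beta.
Variables (n M : nat) (nM : n = (M * 2)%N).
Variables (T : finType) (f : 'I_n -> T) (f' : T -> 'I_n).
Hypotheses (fK : cancel f f') (f'K : cancel f' f).
Variables (D : Type) (J : D -> D -> rat).
Hypothesis JN : forall i j, J i j = - J j i.
Implicit Types (m : matching T) (c : T -> D).

Definition chords_on m : chord_diagram n := transport f'K fK m.

(** For [J] the symplectic matrix, the coefficient at the basis tensor [c] of the form of a diagram.
    The sign refers to a linear order, so the points of [T] are numbered through [f]. *)
Definition beta m c : rat := (-1) ^+ chord_perm (chords_on m) *
  \prod_(i : 'I_n | (i < chords_on m i)%N) J (c (f i)) (c (f (chords_on m i))).

Let word m x := f (chord_point nM (chords_on m) x).
Let flip (x : 'I_M * 'I_2) := (x.1, rev_ord x.2).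

Let word_inj m : injective (word m).
Proof.
by move=> x y /(can_inj fK) /perm_inj /(can_inj (pair_pointK nM)).
Qed.

Let word_mate m x : m (word m x) = word m (flip x).
Proof.
have E r : m (word m (r, ord0)) = word m (r, ord_max).
  by rewrite /word -mate_chord_point /chords_on ffunE f'K.
case: x => r j; rewrite /flip /=.
have [->|->] : j = ord0 \/ j = ord_max.
  by case: j => -[|[|]] // j2; [left|right]; apply/val_inj.
- by rewrite E; congr word; congr pair; apply/val_inj.
- by rewrite -E mateK; congr word; congr pair; apply/val_inj.
Qed.

Let beta_word m c :
  beta m c = (-1) ^+ chord_perm (chords_on m) * pair_form J (c \o word m).
Proof.
rewrite /beta (prod_chords nM); congr (_ * _); apply: eq_bigr => r _.
by rewrite mate_chord_point.
Qed.

(** The map [s] carries the word of [m] to that of [m'] up to a permutation [w] of the positions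
    which respects the chords. The sign of [w], produced by the pair form, is the product of the
    signs of [s] and of the two words. *)
Lemma beta_relabel (s : {perm T}) m m' c : (forall x, m' (s x) = s (m x)) ->
  beta m' c = (-1) ^+ s * beta m (c \o s).
Proof.
move=> mm'; pose u := chord_perm (chords_on m); pose u' := chord_perm (chords_on m').
have sn_inj : injective (fun i => f' (s (f i))).
  by move=> i j /(can_inj f'K) /perm_inj /(can_inj fK).
(* From a position in the word of [m] to its point, along [s], and back to a position in the word of
   [m']. *)
pose v := (u * perm sn_inj * u'^-1)%g.
have w_inj : injective (fun x => point_pair nM (v (pair_point nM x))).
  by move=> x y /(can_inj (point_pairK nM)) /perm_inj /(can_inj (pair_pointK nM)).
pose w := perm w_inj.
have wE x : word m' (w x) = s (word m x).
  rewrite /word /chord_point permE point_pairK /v !permM permKV permE f'K //.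
have odd_w : odd_perm w = odd_perm u (+) odd_perm s (+) odd_perm u'.
  have <- : odd_perm v = odd_perm w.
    apply: (odd_perm_conj (pair_pointK nM) (point_pairK nM)) => x.
    by rewrite [w x]permE point_pairK.
  rewrite !odd_permM odd_permV; congr (_ (+) _ (+) _).
  by apply: esym; apply: (odd_perm_conj fK f'K) => i; rewrite permE f'K.
(* In both words passing to the mate is the flip of positions, so [w] commutes with [flip] and
   preserves the pairs of positions. *)
have w_flip x : w (flip x) = flip (w x).
  by apply: (@word_inj m'); rewrite wE -!word_mate wE mm'.
have w_block x y : ((w x).1 == (w y).1) = (x.1 == y.1).
  have pairE (a b : 'I_M * 'I_2) : (a.1 == b.1) = (a == b) || (a == flip b).
    case: a b => [r i] [r' j]; rewrite /flip !xpair_eqE /= -andb_orr.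
    case: (r == r') => //=; case: i j => -[|[|]] // i2 [[|[|]] // j2].
  by rewrite pairE -w_flip !(inj_eq perm_inj) -pairE.
rewrite !beta_word -/u -/u'.
have -> : (c \o s) \o word m = fun x => (c \o word m') (w x).
  by apply: funext => x; rewrite /= wE.
rewrite pair_form_antisymmetry // odd_w !mulrA -!signr_addb; congr (_ ^+ _ * _).
by case: (odd_perm u); case: (odd_perm s); case: (odd_perm u').
Qed.

End Beta.

(** * Surgery at one pair *)

(** An edge contributes through its left end only, whence the sign when [a] is the right one. The
    predicate [P] allows a second edge to be extracted after a first. *)
Lemma prod_edge (n : nat) (C : chord_diagram n) (P : pred 'I_n) (F : 'I_n -> rat) a :
    (forall i, F (C i) = - F i) -> P a -> P (C a) ->
  \prod_(i : 'I_n | P i && (i < C i)%N) F i = (-1) ^+ (C a < a)%N * F a *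
    \prod_(i : 'I_n | [&& P i, i != a & i != C a] && (i < C i)%N) F i.
Proof.
move=> FC Pa PCa; have aC : a != C a by rewrite eq_sym mate_neq.
have aCn : val a != val (C a) by rewrite (inj_eq val_inj).
have [aCa|Caa|/eqP] := ltngtP (C a) a; last by rewrite eq_sym (negPf aCn).
  rewrite mulN1r -FC (bigD1 (C a)) /=; last by rewrite PCa mateK.
  congr (_ * _); apply: eq_bigl => i; have [->|] := eqVneq i a; last first.
    by case: (P i); case: (i < C i)%N; case: (i == C a).
  by rewrite andbF /= ltnNge (ltnW aCa) andbF.
rewrite mul1r (bigD1 a) ?Pa //; congr (_ * _); apply: eq_bigl => i.
have [->|] := eqVneq i (C a); first by rewrite mateK ltnNge (ltnW Caa) !andbF.
by case: (P i); case: (i < C i)%N; case: (i == a).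
Qed.

Section PairSurgery.
Variables (T : finType) (m : matching T) (a b : T).

(* Conjugation by the transposition replaces the edges {a, m a} and {b, m b}  *)
(* by {a, b} and {m a, m b}; this makes its sign immediate.                   *)
Definition pair_surgery : matching T :=
  if m a == b then m
  else transport (permK (tperm (m a) b)) (permKV (tperm (m a) b)) m.

Lemma pair_surgery_eq : m a = b -> pair_surgery = m.
Proof. by rewrite /pair_surgery => ->; rewrite eqxx. Qed.

Lemma pair_surgery_tperm x : m a != b ->
  pair_surgery (tperm (m a) b x) = tperm (m a) b (m x).
Proof. by rewrite /pair_surgery => /negPf->; rewrite ffunE permK. Qed.

Hypotheses (ab : a != b) (mab : m a != b).

Let amb : a != m b.
Proof. by apply: contra_neq mab => ->; rewrite mateK. Qed.

Lemma pair_surgery_l : pair_surgery a = b.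
Proof.
have := pair_surgery_tperm a mab.
by rewrite tpermL tpermD // ?mate_neq // eq_sym.
Qed.

Lemma pair_surgery_outer : pair_surgery (m a) = m b.
Proof.
have := pair_surgery_tperm b mab.
rewrite tpermR tpermD // ?(inj_eq (inv_inj (mateK m))) //.
by rewrite eq_sym mate_neq.
Qed.

Lemma pair_surgery_outer' : pair_surgery (m b) = m a.
Proof. by rewrite -pair_surgery_outer mateK. Qed.

Lemma pair_surgery_other x :
  x != a -> x != b -> x != m a -> x != m b -> pair_surgery x = m x.
Proof.
move=> xa xb xma xmb; have := pair_surgery_tperm x mab.
rewrite !tpermD // eq_sym ?(inj_eq (inv_inj (mateK m))) //.
by apply: contra_neq xmb => <-; rewrite mateK.
Qed.

End PairSurgery.

(** * Pairing the form of a matching with a tensor *)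

Section Pairing.
Variables (n M : nat) (nM : n = (M * 2)%N).
Variables (T : finType) (f : 'I_n -> T) (f' : T -> 'I_n).
Hypotheses (fK : cancel f f') (f'K : cancel f' f).
Variables (D : finType) (J : D -> D -> rat).
Hypothesis JN : forall i j, J i j = - J j i.
Hypothesis JJ : forall i k, \sum_j J i j * J j k = - (i == k)%:R.
Implicit Types (m : matching T) (t : {ffun {ffun T -> D} -> rat}).

Local Notation beta := (beta fK f'K J).

Definition pairing m t : rat := \sum_(c : {ffun T -> D}) beta m c * t c.

Let F m (c : T -> D) i := J (c (f i)) (c (f (chords_on fK f'K m i))).

Let chords_onE m x : chords_on fK f'K m (f' x) = f' (m x).
Proof. by rewrite ffunE f'K. Qed.

Let FN m c i : F m c (chords_on fK f'K m i) = - F m c i.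
Proof. by rewrite /F mateK JN. Qed.

Let FE m c x : F m c (f' x) = J (c x) (c (m x)).
Proof. by rewrite /F chords_onE !f'K. Qed.

Let betaE m c : beta m c = (-1) ^+ chord_perm (chords_on fK f'K m) *
  \prod_(i : 'I_n | true && (i < chords_on fK f'K m i)%N) F m c i.
Proof. by []. Qed.

Let F_eq m (c c' : T -> D) i : c (f i) = c' (f i) -> c (m (f i)) = c' (m (f i)) ->
  F m c i = F m c' i.
Proof. by move=> e e'; rewrite -[i]fK !FE e e'. Qed.

(** The cofactor [R] does not see the values of [c] at the two ends of the edge, so these can be
    summed over freely. *)
Let beta_edge m a : exists R : (T -> D) -> rat,
  (forall c c' : T -> D, (forall x, x != a -> x != m a -> c x = c' x) -> R c = R c') /\
  forall c, beta m c = J (c a) (c (m a)) * R c.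
Proof.
have e c := @prod_edge n (chords_on fK f'K m) predT (F m c) (f' a) (FN m c) isT isT.
exists (fun c => (-1) ^+ chord_perm (chords_on fK f'K m) *
    (-1) ^+ (f' (m a) < f' a)%N *
    \prod_(i : 'I_n | [&& true, i != f' a & i != f' (m a)] &&
                       (i < chords_on fK f'K m i)%N) F m c i).
split=> [c c' cc'|c]; last first.
  by rewrite betaE e FE chords_onE -[X in _ * X]mulrA mulrA mulrCA.
congr (_ * _); apply: eq_bigr => i /andP[/and3P[_ ia ima] _].
apply: F_eq => //; apply: cc'.
- by apply: contra_neq ia => <-; rewrite fK.
- by apply: contra_neq ima => <-; rewrite fK.
- by apply: contra_neq ima => <-; rewrite mateK fK.
- by apply: contra_neq ia => /(inv_inj (mateK m)) <-; rewrite fK.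
Qed.

Let beta_edge2 m a b : a != b -> m a != b -> exists R : (T -> D) -> rat,
  (forall c c' : T -> D, (forall x, x != a -> x != m a -> x != b -> x != m b ->
     c x = c' x) -> R c = R c') /\
  forall c, beta m c = J (c a) (c (m a)) * J (c b) (c (m b)) * R c.
Proof.
move=> ab mab; have amb : a != m b by apply: contra_neq mab => ->; rewrite mateK.
have f'_inj := can_inj f'K.
have e1 c := @prod_edge n (chords_on fK f'K m) predT (F m c) (f' a) (FN m c) isT isT.
pose P i := [&& true, i != f' a & i != chords_on fK f'K m (f' a)].
have Pb : P (f' b).
  by rewrite /P chords_onE !(inj_eq f'_inj) (eq_sym b) ab (eq_sym b) mab.
have Pmb : P (chords_on fK f'K m (f' b)).
  rewrite /P !chords_onE !(inj_eq f'_inj) (inj_eq (inv_inj (mateK m))).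
  by rewrite (eq_sym b) ab (eq_sym (m b)) amb.
have e2 c := @prod_edge n (chords_on fK f'K m) P (F m c) (f' b) (FN m c) Pb Pmb.
exists (fun c => (-1) ^+ chord_perm (chords_on fK f'K m) *
    (-1) ^+ (f' (m a) < f' a)%N * (-1) ^+ (f' (m b) < f' b)%N *
    \prod_(i : 'I_n | [&& P i, i != f' b & i != f' (m b)] &&
                       (i < chords_on fK f'K m i)%N) F m c i).
split=> [c c' cc'|c]; last first.
  have alg (s x1 y1 x2 y2 p : rat) :
      s * (x1 * y1 * (x2 * y2 * p)) = y1 * y2 * (s * x1 * x2 * p) by ring.
  by rewrite betaE e1 -/P e2 !FE !chords_onE alg.
congr (_ * _); apply: eq_bigr => i; rewrite /P chords_onE.
move=> /andP[/and3P[/and3P[_ ia ima] ib imb] _].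
have ne x : i != f' x -> f i != x by apply: contra_neq => <-; rewrite fK.
have nem x : i != f' (m x) -> m (f i) != x.
  by move=> /ne; apply: contra_neq => <-; rewrite mateK.
have nem' x : i != f' x -> m (f i) != m x.
  by move=> /ne; rewrite (inj_eq (inv_inj (mateK m))).
by apply: F_eq; apply: cc'; first [exact: ne | exact: nem' | exact: nem].
Qed.

Definition upd (a b : T) (i j : D) (c : {ffun T -> D}) : {ffun T -> D} :=
  [ffun x => if x == a then i else if x == b then j else c x].

(* The counterpart for tensors of cutting a graph at one vertex. *)
Definition contract_pair (a b : T) t : {ffun {ffun T -> D} -> rat} :=
  [ffun c : {ffun T -> D} =>
     J (c a) (c b) * \sum_i \sum_j J i j * t (upd a b i j c)].

(** The operator [contract_pair] is symmetric: the involution exchanging the values of [c] at [a]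
    and [b] with the summation indices moves it from [t] to [beta m]. *)
Lemma pairing_contract_pair m a b t : a != b ->
  pairing m (contract_pair a b t) = \sum_(c : {ffun T -> D})
    J (c a) (c b) * (\sum_i \sum_j J i j * beta m (upd a b i j c)) * t c.
Proof.
move=> ab; rewrite /pairing.
pose s (p : {ffun T -> D} * (D * D)) := (upd a b p.2.1 p.2.2 p.1, (p.1 a, p.1 b)).
have ba : (b == a) = false by rewrite eq_sym (negPf ab).
have sK : involutive s.
  move=> [c [i j]]; rewrite /s /= !ffunE !eqxx ba; congr pair.
  apply/ffunP => x; rewrite !ffunE.
  by have [->|xa] := eqVneq x a; last have [->|xb] := eqVneq x b.
have sumE (G : {ffun T -> D} -> D -> D -> rat) :
    \sum_(c : {ffun T -> D}) \sum_i \sum_j G c i j = \sum_p G p.1 p.2.1 p.2.2.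
  rewrite -(pair_bigA _ (fun c q => G c q.1 q.2)) /=.
  by apply: eq_bigr => c _; rewrite (pair_bigA _ (G c)).
transitivity (\sum_(c : {ffun T -> D}) \sum_i \sum_j
    beta m c * J (c a) (c b) * J i j * t (upd a b i j c)).
  apply: eq_bigr => c _; rewrite ffunE !mulr_sumr; apply: eq_bigr => i _.
  by rewrite !mulr_sumr; apply: eq_bigr => j _; ring.
transitivity (\sum_(c : {ffun T -> D}) \sum_i \sum_j
    J (c a) (c b) * J i j * beta m (upd a b i j c) * t c); last first.
  apply: eq_bigr => c _; rewrite mulr_sumr mulr_suml; apply: eq_bigr => i _.
  by rewrite mulr_sumr mulr_suml; apply: eq_bigr => j _; ring.
rewrite !sumE (reindex_inj (inv_inj sK)); apply: eq_bigr => -[c [i j]] _ /=.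
rewrite !ffunE !eqxx ba.
have -> : upd a b (c a) (c b) (upd a b i j c) = c.
  by have [] := sK (c, (i, j)); rewrite /s /= !ffunE !eqxx ba.
ring.
Qed.

(** This is the cube of [J], whose square is [-1]. *)
Lemma sum_JJJ x y : \sum_i \sum_j J i j * (J x i * J j y) = - J x y.
Proof.
transitivity (\sum_i J x i * - (i == y)%:R).
  apply: eq_bigr => i _; rewrite -JJ mulr_sumr; apply: eq_bigr => j _; ring.
rewrite (bigD1 y) //= eqxx mulrN1 big1 ?addr0 // => i /negPf->.
by rewrite oppr0 mulr0.
Qed.

(** By antisymmetry this is minus the trace of the square of [J]. *)
Lemma sum_JJ : \sum_i \sum_j J i j * J i j = #|D|%:R.
Proof.
rewrite -sumr_const; apply: eq_bigr => i _.
transitivity (- \sum_j J i j * J j i); last by rewrite JJ eqxx opprK.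
by rewrite -sumrN; apply: eq_bigr => j _; rewrite [X in _ * X]JN mulrN.
Qed.

(** If [a] and [b] are mates, the inner sum is [sum_JJ] and contributes [#|D|], that is
    [- (- #|D|)]. Otherwise [sum_JJJ] joins the two former mates, and the remaining sign is that of
    the transposition defining [pair_surgery]. *)
Lemma pairing_surgery m a b t : a != b ->
  pairing m (contract_pair a b t) =
  - (- #|D|%:R) ^+ (m a == b) * pairing (pair_surgery m a b) t.
Proof.
move=> ab; rewrite pairing_contract_pair // /pairing mulr_sumr.
apply: eq_bigr => c _; rewrite mulrA; congr (_ * _).
have ba : (b == a) = false by rewrite eq_sym (negPf ab).
have [mab|mab] := eqVneq (m a) b.
  rewrite pair_surgery_eq //; have [R [R_eq RE]] := beta_edge m a.
  rewrite RE mab expr1 opprK mulrCA; congr (_ * _).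
  rewrite -sum_JJ mulr_suml; apply: eq_bigr => i _.
  rewrite mulr_suml; apply: eq_bigr => j _.
  rewrite RE mab !ffunE !eqxx ba mulrA; congr (_ * _); apply: R_eq => x xa.
  by rewrite mab => xb; rewrite ffunE (negPf xa) (negPf xb).
rewrite expr0 mulN1r.
have mm' x := pair_surgery_tperm x mab.
rewrite (beta_relabel nM fK f'K JN c mm').
rewrite odd_tperm mab mulN1r opprK.
have [R [R_eq RE]] := beta_edge2 ab mab.
have maa : m a != a by exact: mate_neq.
have mbb : m b != b by exact: mate_neq.
have mba : m b != a by apply: contra_neq mab => <-; rewrite mateK.
have mamb : m a != m b by rewrite (inj_eq (inv_inj (mateK m))).
have -> : beta m (c \o tperm (m a) b) = J (c a) (c b) * J (c (m a)) (c (m b)) * R c.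
  rewrite RE /= tpermL tpermR !tpermD //; rewrite 1?eq_sym // -1?eq_sym //.
  rewrite (R_eq _ c); last first.
    by move=> x xa xma xb xmb; rewrite /= tpermD // eq_sym.
  by [].
(* The edges at [a] and [b] give [J i (c (m a))] and [J j (c (m b))]; turning the first around
   yields a chain from [m a] through [i] and [j] to [m b]. *)
rewrite -mulrA; congr (_ * _); rewrite -[J _ _]opprK -sum_JJJ -sumrN mulr_suml.
apply: eq_bigr => i _; rewrite -sumrN mulr_suml; apply: eq_bigr => j _.
rewrite RE !ffunE !eqxx ba (negPf maa) (negPf mab) (negPf mba) (negPf mbb).
rewrite (R_eq _ c); last first.
  by move=> x xa xma xb xmb; rewrite ffunE (negPf xa) (negPf xb).
rewrite [J i (c (m a))]JN; ring.
Qed.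

End Pairing.

(** * Iterated surgery *)

Section Circles.
Variables (T : finType) (m : matching T) (S : pred T) (q : T -> T).

(** This and the next definition are [circle_rel] and [circles] over an arbitrary finite type and
    set of pairs, so that pairs can be removed one at a time. *)
Definition alternating_rel : rel T := fun x y => (y == m x) || S x && (y == q x).

Definition alternating_circles : {set {set T}} :=
  [set B in [set [set y | connect alternating_rel x y] | x : T] | B \subset S].

Hypotheses (qK : forall x, S x -> q (q x) = x) (qS : forall x, S x -> S (q x)).

Lemma alternating_connect_sym : connect_sym alternating_rel.
Proof.
apply: sym_connect_sym => x y; rewrite /alternating_rel.
have mE u v : (u == m v) = (v == m u).
  by apply/eqP/eqP => ->; rewrite mateK.
rewrite mE; congr (_ || _).
by apply/andP/andP => -[Su /eqP ->]; rewrite qK // eqxx qS.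
Qed.

Lemma mem_circle B x : B \in alternating_circles -> x \in B ->
  B = [set y | connect alternating_rel x y].
Proof.
rewrite inE => /andP[/imsetP[z _ ->] _]; rewrite inE => zx; apply/setP => y.
by rewrite !inE (same_connect alternating_connect_sym zx).
Qed.

Lemma circleP x :
  reflect (forall y, connect alternating_rel x y -> S y)
    ([set y | connect alternating_rel x y] \in alternating_circles).
Proof.
rewrite inE imset_f //=; apply: (iffP subsetP) => h y; first by move=> xy; apply: h; rewrite inE.
by rewrite inE; exact: h.
Qed.

End Circles.

Section SurgeryPath.
Variables (T : finType) (m : matching T).
Variables (S : pred T) (q : T -> T).
Hypotheses (qK : forall x, S x -> q (q x) = x) (q_neq : forall x, S x -> q x != x).
Hypothesis (qS : forall x, S x -> S (q x)).

(** Walks stop outside [S], so any iterate outside [S] is the final one, and the bound [#|T|] on the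
    number of steps can be forgotten. *)
Lemma surgery_exit x k y : ~~ S x -> iter k (surgery_step m S q) (m x) = y -> ~~ S y ->
  surgery m qK q_neq qS x = y.
Proof.
move=> Sx xy Sy; set z := surgery _ _ _ _ x.
have zE : z = iter #|T| (surgery_step m S q) (m x) by rewrite /z /= ffunE (negPf Sx).
(* If [z] were in [S], the involution would send it back to [x = q z], again in [S]. *)
have Sz : ~~ S z.
  apply/negP => Sz; have := mateK (surgery m qK q_neq qS) x.
  by rewrite -/z /= ffunE Sz => e; move: Sx; rewrite -e qS.
have stay i u : ~~ S u -> iter i (surgery_step m S q) u = u.
  by move=> Su; elim: i => //= i ->; rewrite /surgery_step (negPf Su).
rewrite -(stay k z) // zE -xy -iterD addnC iterD xy.
by rewrite stay.
Qed.

Lemma surgery_in x : S x -> surgery m qK q_neq qS x = q x.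
Proof. by move=> Sx; rewrite /= ffunE Sx. Qed.

Lemma surgery_reach x : ~~ S x -> exists2 k,
  iter k (surgery_step m S q) (m x) = surgery m qK q_neq qS x &
  ~~ S (surgery m qK q_neq qS x).
Proof.
move=> Sx; exists #|T|; first by rewrite /= ffunE (negPf Sx).
apply/negP => Sz; have := mateK (surgery m qK q_neq qS) x.
by rewrite (surgery_in Sz) => e; move: Sx; rewrite -e qS.
Qed.

End SurgeryPath.

(** * Splitting one pair off a surgery *)

Section SurgeryStep.
Variables (T : finType) (m : matching T).
Variables (S : pred T) (q : T -> T).
Hypotheses (qK : forall x, S x -> q (q x) = x) (q_neq : forall x, S x -> q x != x).
Hypothesis (qS : forall x, S x -> S (q x)).
Variables (S1 : pred T) (q1 : T -> T).
Hypotheses (q1K : forall x, S1 x -> q1 (q1 x) = x).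
Hypotheses (q1_neq : forall x, S1 x -> q1 x != x) (q1S : forall x, S1 x -> S1 (q1 x)).
Variables (a b : T).
Hypotheses (Sa : S a) (qa : q a = b).
Hypothesis S1E : forall x, S1 x = [&& S x, x != a & x != b].
Hypothesis q1E : forall x, S1 x -> q1 x = q x.
Local Notation m1 := (pair_surgery m a b).

Let Sb : S b. Proof. by rewrite -qa qS. Qed.
Let qb : q b = a. Proof. by rewrite -qa qK. Qed.
Let ab : a != b. Proof. by rewrite -qa eq_sym q_neq. Qed.

Let m1a : m1 a = b.
Proof. by case: (eqVneq (m a) b) => mab; [rewrite pair_surgery_eq | exact: pair_surgery_l]. Qed.

Let q_off x : S x -> x != a -> x != b -> (q x != a) && (q x != b).
Proof.
move=> Sx xa xb; apply/andP; split.
  by apply: contra_neq xb => e; rewrite -(qK Sx) e qa.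
by apply: contra_neq xa => e; rewrite -(qK Sx) e qb.
Qed.

(** A walk for [S] that arrives at [a] crosses to [b] and goes on to [m b], and symmetrically from
    [b]; [hop] records the outcome of the crossing. *)
Let hop x := if x == a then m b else if x == b then m a else x.

Let m1_hop x : m a != b -> x != a -> x != b -> m1 x = hop (m x).
Proof.
move=> mab xa xb; rewrite /hop; have [e|mxa] := eqVneq (m x) a.
  by rewrite -[x](mateK m) e pair_surgery_outer.
have [e|mxb] := eqVneq (m x) b.
  by rewrite -[x](mateK m) e pair_surgery_outer'.
rewrite pair_surgery_other //.
  by apply: contra_neq mxa => ->; rewrite mateK.
by apply: contra_neq mxb => ->; rewrite mateK.
Qed.

Let hop_id x : x != a -> x != b -> hop x = x.
Proof. by rewrite /hop => /negPf-> /negPf->. Qed.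

(** The walk for [S1] shadows the walk for [S], saving one step at each crossing of the pair. *)
Let track k x : m a != b -> ~~ S (iter k (surgery_step m S q) x) ->
  exists k', iter k' (surgery_step m1 S1 q1) (hop x) = iter k (surgery_step m S q) x.
Proof.
move=> mab; elim: k x => [|k IH] x Sk.
  exists 0%N; rewrite /= hop_id //; apply: contraNneq Sk => /= ->.
    exact: Sa.
  exact: Sb.
rewrite iterSr in Sk *; case: (boolP (S x)) => Sx; last first.
  by have := IH x; rewrite /surgery_step (negPf Sx) in Sk * => /(_ Sk).
have [k' kE] := IH _ Sk; rewrite -kE.
(* As [a] and [b] are not mates, the point reached after a crossing lies off the pair. *)
have mbo : hop (m b) = m b.
  by rewrite hop_id ?mate_neq //; apply: contra_neq mab => <-; rewrite mateK.
have mao : hop (m a) = m a by rewrite hop_id ?mate_neq.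
rewrite /surgery_step Sx; have [->|xa] := eqVneq x a.
  by exists k'; rewrite qa mbo /hop eqxx.
have [->|xb] := eqVneq x b.
  by exists k'; rewrite qb mao /hop eq_sym (negPf ab) eqxx.
exists k'.+1; rewrite iterSr hop_id //; congr iter.
have S1x : S1 x by rewrite S1E Sx xa.
by have /andP[qxa qxb] := q_off Sx xa xb; rewrite /surgery_step S1x q1E // m1_hop.
Qed.

(** If [a] and [b] are not mates, [track] compares the two walks. If they are, [m1] is [m], and the
    pair is a closed circle which no walk from outside [S] meets. *)
Lemma surgery_pair_surgery :
  surgery m1 q1K q1_neq q1S = surgery m qK q_neq qS.
Proof.
have E x : surgery m1 q1K q1_neq q1S x = surgery m qK q_neq qS x; last first.
  by apply/val_inj/ffunP.
case: (boolP (S1 x)) => S1x.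
  have Sx : S x by move: S1x; rewrite S1E => /andP[].
  by rewrite !surgery_in // q1E.
have S1a : ~~ S1 a by rewrite S1E eqxx /= andbF.
have S1b : ~~ S1 b by rewrite S1E eqxx /= !andbF.
have [xa|xa] := eqVneq x a.
  rewrite xa [RHS]surgery_in // qa.
  by apply: (@surgery_exit _ _ _ _ _ _ _ _ 0%N).
have [xb|xb] := eqVneq x b.
  rewrite xb [RHS]surgery_in // qb.
  apply: (@surgery_exit _ _ _ _ _ _ _ _ 0%N) => //=.
  by rewrite -[RHS](mateK m1) m1a.
have Sx : ~~ S x by move: S1x; rewrite S1E xa xb !andbT.
have [k <- Sk] := surgery_reach m qK q_neq qS Sx.
have S1k : ~~ S1 (iter k (surgery_step m S q) (m x)).
  by rewrite S1E; apply: contra Sk => /andP[].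
have [mab|mab] := eqVneq (m a) b; last first.
  have [k' kE] := track mab Sk; rewrite -kE.
  apply: (@surgery_exit _ _ _ _ _ _ _ _ k') => //; last by rewrite kE.
  by rewrite m1_hop.
apply: (@surgery_exit _ _ _ _ _ _ _ _ k) => //; rewrite (pair_surgery_eq mab).
(* The pair is now also an edge, so walks started off it stay off it, where the two step functions
   agree. *)
have m_off y : y != a -> y != b -> (m y != a) && (m y != b).
  move=> ya yb; rewrite -mab (inj_eq (inv_inj (mateK m))) ya andbT.
  by apply: contra_neq yb => e; rewrite -mab -e mateK.
have /andP[] := m_off x xa xb; move: (m x) => {Sk S1k}.
elim: k => // k IH u ua ub; rewrite !iterSr.
have -> : surgery_step m S1 q1 u = surgery_step m S q u.
  rewrite /surgery_step S1E ua ub !andbT; case: ifP => // Su.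
  by rewrite q1E // S1E Su ua.
rewrite IH // /surgery_step; case: ifP => // Su.
  by have /andP[qua qub] := q_off Su ua ub; have /andP[] := m_off _ qua qub.
by have /andP[qua qub] := q_off Su ua ub; have /andP[] := m_off _ qua qub.
Qed.

Local Notation e := (alternating_rel m S q).
Local Notation e1 := (alternating_rel m1 S1 q1).

Let m1b : m1 b = a. Proof. by rewrite -[RHS](mateK m1) m1a. Qed.

(** The pair is an edge of [m1] and [S1] avoids its two points, so it is a whole component. *)
Let connect1_pair x y : (x == a) || (x == b) -> connect e1 x y -> (y == a) || (y == b).
Proof.
move=> xab /connectP[p xp ->]; elim: p x xab xp => //= z p IH x xab /andP[xz].
apply: IH; move: xz; rewrite /alternating_rel S1E.
by case/orP: xab => /eqP->; rewrite ?m1a ?m1b eqxx /= ?andbF orbF => /eqP->;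
  rewrite eqxx ?orbT.
Qed.

Let connect1_off x y : x != a -> x != b -> connect e1 x y -> (y != a) && (y != b).
Proof.
move=> xa xb; rewrite (alternating_connect_sym _ q1K q1S) -negb_or => yx.
by apply/negP => /connect1_pair /(_ yx); rewrite (negPf xa) (negPf xb).
Qed.

Let connect_hop x : connect e x (hop x).
Proof.
rewrite /hop; case: eqP => [->|_].
  apply: (connect_trans (y := b)); apply: connect1; rewrite /alternating_rel ?eqxx //.
  by rewrite Sa qa eqxx orbT.
case: eqP => [->|_]; last exact: connect0.
apply: (connect_trans (y := a)); apply: connect1; rewrite /alternating_rel ?eqxx //.
by rewrite Sb qb eqxx orbT.
Qed.

Let connect1_sub x y : connect e1 x y -> connect e x y.
Proof.
apply: connect_sub => {}x {}y /orP[/eqP->|/andP[S1x /eqP->]]; last first.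
  apply: connect1; move: S1x (S1x); rewrite {1}S1E /alternating_rel => /andP[-> _] S1x.
  by rewrite q1E // eqxx orbT.
have [->|xa] := eqVneq x a.
  by rewrite m1a; apply: connect1; rewrite /alternating_rel Sa qa eqxx orbT.
have [->|xb] := eqVneq x b.
  by rewrite m1b; apply: connect1; rewrite /alternating_rel Sb qb eqxx orbT.
have xm : connect e x (m x) by apply: connect1; rewrite /alternating_rel eqxx.
have [mab|mab] := eqVneq (m a) b; first by rewrite pair_surgery_eq.
by rewrite m1_hop //; exact: connect_trans xm (connect_hop _).
Qed.

(** Replacing the points of the pair by where a crossing leads turns each step for [e] into a path
    for [e1]. *)
Let connect_hop_hop x y : m a != b -> connect e x y -> connect e1 (hop x) (hop y).
Proof.
move=> mab /connectP[p xp ->]; elim: p x xp => [x _|z p IH x] /=.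
  exact: connect0.
case/andP=> xz /IH; apply: connect_trans.
have mba : m b != a by apply: contra_neq mab => <-; rewrite mateK.
have hmb : hop (m b) = m b by rewrite hop_id ?mate_neq.
have hma : hop (m a) = m a by rewrite hop_id ?mate_neq.
have ha : hop a = m b by rewrite /hop eqxx.
have hb : hop b = m a by rewrite /hop eq_sym (negPf ab) eqxx.
have step u : connect e1 u (m1 u) by apply: connect1; rewrite /alternating_rel eqxx.
have [xa|xa] := eqVneq x a.
  move: xz; rewrite xa /alternating_rel Sa qa /= => /orP[] /eqP->; rewrite ha ?hma ?hb.
    by rewrite -(pair_surgery_outer' ab mab); exact: step.
  by rewrite -(pair_surgery_outer' ab mab); exact: step.
have [xb|xb] := eqVneq x b.
  move: xz; rewrite xb /alternating_rel Sb qb /= => /orP[] /eqP->; rewrite hb ?hmb ?ha.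
    by rewrite -(pair_surgery_outer ab mab); exact: step.
  by rewrite -(pair_surgery_outer ab mab); exact: step.
rewrite (hop_id xa xb); case/orP: xz => [/eqP->|/andP[Sx /eqP->]].
  by rewrite -m1_hop //; exact: step.
have /andP[qxa qxb] := q_off Sx xa xb; rewrite hop_id //; apply: connect1.
have S1x : S1 x by rewrite S1E Sx xa xb.
by rewrite /alternating_rel S1x q1E // eqxx orbT.
Qed.

Let connect_off x y : x != a -> x != b -> y != a -> y != b ->
  connect e x y -> connect e1 x y.
Proof.
move=> xa xb ya yb xy; have [mab|mab] := eqVneq (m a) b; last first.
  by rewrite -[x]hop_id // -[y]hop_id //; exact: connect_hop_hop.
case/connectP: xy => p xp ->; elim: p x xa xb xp => [x *|z p IH x xa xb] /=.
  exact: connect0.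
case/andP=> xz; have : connect e1 x z && (z != a) && (z != b).
  case/orP: xz => [/eqP->|/andP[Sx /eqP->]].
    rewrite connect1 /=; last by rewrite /alternating_rel pair_surgery_eq // eqxx.
    rewrite -mab (inj_eq (inv_inj (mateK m))) xa andbT.
    by apply: contra_neq xb => e; rewrite -mab -e mateK.
  rewrite -andbA q_off // andbT connect1 // /alternating_rel S1E Sx xa xb /= q1E ?eqxx ?orbT //.
  by rewrite S1E Sx xa xb.
by move=> /andP[/andP[xz1 za] zb] /(IH _ za zb); exact: connect_trans.
Qed.

Let circle_off B : m a != b -> B \in alternating_circles m S q ->
  exists x, [/\ x \in B, x != a & x != b].
Proof.
move=> mab; rewrite inE => /andP[/imsetP[x _ ->] _].
have [xa|xa] := eqVneq x a; last have [xb|xb] := eqVneq x b.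
- exists (m a); rewrite inE mate_neq mab xa; split=> //.
  by apply: connect1; rewrite /alternating_rel eqxx.
- exists (m b); rewrite inE mate_neq xb; split=> //.
    by apply: connect1; rewrite /alternating_rel eqxx.
  by apply: contra_neq mab => <-; rewrite mateK.
- by exists x; rewrite inE; split=> //; exact: connect0.
Qed.

Let pair_closed x y : m a = b -> (x == a) || (x == b) -> connect e x y ->
  (y == a) || (y == b).
Proof.
move=> mab xab /connectP[p xp ->]; elim: p x xab xp => //= z p IH x xab /andP[xz].
apply: IH; move: xz; rewrite /alternating_rel.
have mb : m b = a by rewrite -mab mateK.
by case/orP: xab => /eqP->; rewrite ?mab ?mb ?qa ?qb => /orP[/eqP->|/andP[_ /eqP->]];
  rewrite eqxx ?orbT.
Qed.

(** Deleting [a] and [b] is a bijection from the circles for [S] other than the pair to the circles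
    for [S1]. The pair is a circle for [S] exactly when [m a = b]; for [S1] it is a component, but
    not one inside [S1]. *)
Lemma card_circles_pair_surgery :
  #|alternating_circles m S q| = ((m a == b) + #|alternating_circles m1 S1 q1|)%N.
Proof.
pose comp x := [set y | connect e x y]; pose comp1 x := [set y | connect e1 x y].
have mem1 x : comp1 x \in alternating_circles m1 S1 q1 ->
    [/\ x != a, x != b & comp x \in alternating_circles m S q].
  move=> /circleP x1; have : S1 x by apply: x1; exact: connect0.
  rewrite S1E => /and3P[Sx xa xb]; split=> //; apply/circleP => y xy.
  have [->//|ya] := eqVneq y a; have [->//|yb] := eqVneq y b.
  by have := x1 y (connect_off xa xb ya yb xy); rewrite S1E => /andP[].
have mem2 x : x != a -> x != b -> comp x \in alternating_circles m S q ->
    comp1 x \in alternating_circles m1 S1 q1.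
  move=> xa xb /circleP xS; apply/circleP => y xy; rewrite S1E xS ?connect1_sub //=.
  exact: connect1_off xy.
have compE x : x != a -> x != b -> comp1 x = comp x :\: [set a; b].
  move=> xa xb; apply/setP => y; rewrite !inE negb_or; apply/idP/idP => [xy|].
    by rewrite (connect1_sub xy) andbT; exact: connect1_off xy.
  by case/andP=> /andP[ya yb]; exact: connect_off.
have off_pair B : B \in alternating_circles m S q -> B != [set a; b] ->
    exists x, [/\ x \in B, x != a & x != b].
  move=> Bc Bab; have [mab|] := eqVneq (m a) b; last by move=> mab; exact: circle_off.
  have := Bc; rewrite inE => /andP[/imsetP[x _ BE] _]; exists x.
  have xB : x \in B by rewrite BE inE connect0.
  have cab y : y \in [set a; b] -> comp y = [set a; b].
    move=> yab; apply/eqP; rewrite eqEsubset; apply/andP; split; apply/subsetP => z.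
      rewrite inE => yz; rewrite !inE; apply: pair_closed yz => //.
      by move: yab; rewrite !inE.
    have ac : connect e a b.
      by apply: connect1; rewrite /alternating_rel mab eqxx.
    have sym := alternating_connect_sym m qK qS.
    by move: yab; rewrite !inE => /orP[]/eqP-> /orP[]/eqP->; rewrite // sym.
  split=> //; apply: contraNneq Bab => xE; rewrite BE -/(comp x) cab //.
    by rewrite xE !inE eqxx.
  by rewrite xE !inE eqxx orbT.
have pair_circle : ([set a; b] \in alternating_circles m S q) = (m a == b).
  apply/idP/eqP => [abc|mab]; last first.
    have <- : comp a = [set a; b].
      apply/setP => z; rewrite !inE; apply/idP/idP => [|/orP[]/eqP->].
      - by apply: pair_closed => //; rewrite eqxx.
      - exact: connect0.
      - by apply: connect1; rewrite /alternating_rel mab eqxx.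
    apply/circleP => z /(pair_closed mab); rewrite eqxx => /(_ isT).
    by case/orP=> /eqP->.
  have aab : a \in [set a; b] by rewrite !inE eqxx.
  have /setP/(_ (m a)) := mem_circle qK qS abc aab; rewrite !inE (negPf (mate_neq m a)) /=.
  by rewrite connect1 => [/eqP|]; rewrite /alternating_rel ?eqxx.
(* A circle other than the pair contains a point off the pair, whose components correspond by
   [compE]. *)
have circ1E : alternating_circles m1 S1 q1 =
    [set B :\: [set a; b] | B in [set B in alternating_circles m S q | B != [set a; b]]].
  apply/setP => B; apply/idP/imsetP.
    move=> Bc; have := Bc; rewrite inE => /andP[/imsetP[x _ BE] _].
    have [xa xb xc] := mem1 x (etrans (congr1 _ (esym BE)) Bc).
    exists (comp x); last by rewrite BE -compE.
    apply/setIdP; split=> //; apply/eqP => /setP/(_ x).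
    by rewrite !inE connect0 (negPf xa) (negPf xb).
  move=> [B' /setIdP[B'c B'ab] ->].
  have [x [xB' xa xb]] := off_pair _ B'c B'ab.
  have B'E := mem_circle qK qS B'c xB'; rewrite B'E -/(comp x) -compE //.
  by apply: mem2; rewrite // /comp -B'E.
have -> : #|alternating_circles m1 S1 q1| =
    #|[set B in alternating_circles m S q | B != [set a; b]]|.
  rewrite circ1E card_in_imset // => B B' /setIdP[Bc Bab] /setIdP[B'c B'ab] BB'.
  have [x [xB xa xb]] := off_pair B Bc Bab.
  have xB' : x \in B'.
    have : x \in B' :\: [set a; b] by rewrite -BB' !inE xB (negPf xa) (negPf xb).
    by rewrite inE => /andP[].
  by rewrite (mem_circle qK qS Bc xB) (mem_circle qK qS B'c xB').
rewrite (cardsD1 [set a; b]) pair_circle; congr addn.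
by apply: eq_card => B; rewrite in_setD1 [RHS]in_set andbC.
Qed.

End SurgeryStep.

(** * Relabelling choices of half-edges *)

Section SurgeryConj.
Variables (T : finType) (m m' : matching T) (S S' : pred T) (q q' : T -> T).
Hypotheses (qK : forall x, S x -> q (q x) = x) (q_neq : forall x, S x -> q x != x).
Hypothesis (qS : forall x, S x -> S (q x)).
Hypotheses (q'K : forall x, S' x -> q' (q' x) = x) (q'_neq : forall x, S' x -> q' x != x).
Hypothesis (q'S : forall x, S' x -> S' (q' x)).
Variable s : {perm T}.
Hypotheses (ms : forall x, m' (s x) = s (m x)) (Ss : forall x, S' (s x) = S x).
Hypothesis qs : forall x, S x -> q' (s x) = s (q x).

Lemma surgery_conj x :
  surgery m' q'K q'_neq q'S (s x) = s (surgery m qK q_neq qS x).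
Proof.
rewrite /= !ffunE Ss; case: ifP => [/qs //|_]; rewrite ms.
elim: #|T| => //= k ->; rewrite /surgery_step Ss.
by case: ifP => // Sk; rewrite qs // ms.
Qed.

Let rel_conj x y :
  alternating_rel m' S' q' (s x) (s y) = alternating_rel m S q x y.
Proof.
rewrite /alternating_rel ms (inj_eq perm_inj) Ss; case: (boolP (S x)) => //= Sx.
by rewrite qs // (inj_eq perm_inj).
Qed.

Let connect_conj x y :
  connect (alternating_rel m' S' q') (s x) (s y) = connect (alternating_rel m S q) x y.
Proof.
apply/idP/idP => /connectP[p]; last first.
  elim: p x => [x _ ->|z p IH x /= /andP[xz zp] yE]; first exact: connect0.
  by apply: connect_trans (IH z zp yE); apply: connect1; rewrite rel_conj.
elim: p x => [x _ /perm_inj ->|z p IH x /= /andP[xz zp] yE]; first exact: connect0.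
rewrite -[z](permKV s) rel_conj in xz zp yE.
by apply: connect_trans (IH _ zp yE); exact: connect1.
Qed.

Lemma card_circles_conj :
  #|alternating_circles m' S' q'| = #|alternating_circles m S q|.
Proof.
rewrite -[RHS](card_imset _ (imset_inj (@perm_inj _ s))); apply: eq_card => B.
have imE x : s @: [set y | connect (alternating_rel m S q) x y] =
    [set y | connect (alternating_rel m' S' q') (s x) y].
  apply/setP => y; rewrite !inE -[y](permKV s) connect_conj.
  by rewrite mem_imset ?inE //; exact: perm_inj.
have subE (A : {set T}) : (s @: A \subset S') = (A \subset S).
  rewrite sub_imset_pre; apply: eq_subset_r => x; rewrite !inE.
  exact: Ss.
apply/idP/imsetP => [|[A]].
  rewrite inE => /andP[/imsetP[x _ ->] xS].
  exists [set y | connect (alternating_rel m S q) (s^-1%g x) y].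
    by rewrite inE imset_f //= -subE imE permKV.
  by rewrite imE permKV.
rewrite inE => /andP[/imsetP[x _ ->] xS] ->.
by rewrite inE subE xS andbT imE imset_f.
Qed.

End SurgeryConj.

Section Choices.
Variable N : nat.
Implicit Types (w : {ffun 'I_N -> option half_edge_pair}) (x y : 'I_N * 'I_3).

(** The set [F] is recovered from the choice, so the double sum over [F] and the choices on [F] can
    be written as one sum over [w]. *)
Definition choice_support w : {set 'I_N} := [set v | w v].

Lemma half_edge_pairE (B : half_edge_pair) i : i \in val B -> val B = [set i; other B i].
Proof.
move=> iB; have [jB ji _] := otherP iB; apply/esym/eqP.
rewrite eqEcard subUset !sub1set iB jB /= cards2 (eq_sym i) ji.
by have /eqP-> := valP B.
Qed.

Lemma partner_unique w x y :
  chosen w x -> chosen w y -> x.1 = y.1 -> x != y -> partner w x = y.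
Proof.
case: x y => [v i] [v' j]; rewrite /chosen /partner /= => + + vv'.
rewrite -{}vv'; case: (w v) => // B iB jB; rewrite xpair_eqE eqxx /= => ij.
by move: jB; rewrite (half_edge_pairE iB) !inE eq_sym (negPf ij) /= => /eqP->.
Qed.

Lemma partner1 w x : (partner w x).1 = x.1.
Proof. by rewrite /partner; case: (w x.1). Qed.

Lemma choice_ext w w' : chosen w =1 chosen w' -> w = w'.
Proof.
move=> e; apply/ffunP => v; have {e} : forall j, chosen w (v, j) = chosen w' (v, j).
  by move=> j; exact: e.
have ne (B : half_edge_pair) : exists j, j \in val B.
  by apply/set0Pn; rewrite -card_gt0 (eqP (valP B)).
rewrite /chosen /=; case: (w v) (w' v) => [B|] [B'|] // e.
- by congr Some; apply/val_inj/setP.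
- by have [j jB] := ne B; have := e j; rewrite jB.
- by have [j jB] := ne B'; have := e j; rewrite jB.
Qed.

Lemma mem_choice_support w v : (v \in choice_support w) = [exists j, chosen w (v, j)].
Proof.
rewrite inE /chosen /=; case: (w v) => [B|] /=; last by apply/esym/existsP => -[].
apply/esym/existsP; have : val B != set0 by rewrite -card_gt0 (eqP (valP B)).
by case/set0Pn => j jB; exists j.
Qed.

Section Move.
Variable s : {perm 'I_N * 'I_3}.
Hypothesis s_block : forall x y, ((s x).1 == (s y).1) = (x.1 == y.1).

(** [insub] gives [None] exactly at the vertices that receive no choice: as [s] respects vertices, a
    nonempty transported set has two elements again. *)
Definition move_choice w : {ffun 'I_N -> option half_edge_pair} :=
  [ffun v => insub [set j | chosen w (s^-1%g (v, j))]].

Lemma chosen_move w x : chosen (move_choice w) (s x) = chosen w x.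
Proof.
rewrite -[in RHS](permK s x); case: (s x) => v i {x}.
rewrite {1}/chosen ffunE /=; set A := [set j | _].
have iA : (i \in A) = chosen w (s^-1%g (v, i)) by rewrite inE.
rewrite -iA; have [|A2] := boolP (#|A| == 2%N); first by move=> A2; rewrite insubT.
rewrite insubN //; apply/esym/negbTE; apply: contra A2 => {}iA.
have block j : (s^-1%g (v, j)).1 = (s^-1%g (v, i)).1.
  by apply/eqP; rewrite -s_block !permKV.
pose h j := (s^-1%g (v, j)).2.
have hE j : s^-1%g (v, j) = ((s^-1%g (v, i)).1, h j).
  by rewrite [LHS]surjective_pairing block.
have h_inj : injective h.
  by move=> j l e; have : s^-1%g (v, j) = s^-1%g (v, l);
     [rewrite (hE j) (hE l) e | move/perm_inj => -[]].
move: iA; rewrite inE {1}/chosen; case wu: (w _) => [B|] // _.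
have -> : A = [set j | perm h_inj j \in val B].
  by apply/setP => j; rewrite !inE hE /chosen /= wu permE.
apply/eqP; transitivity #|val B|; last exact/eqP/(valP B).
rewrite -(card_imset _ (@perm_inj _ (perm h_inj))); apply: eq_card => j.
by rewrite -[j](permKV (perm h_inj)) mem_imset ?inE //; exact: perm_inj.
Qed.

Lemma move_choice_inj : injective move_choice.
Proof.
by move=> w w' e; apply: choice_ext => x; rewrite -(chosen_move w) -(chosen_move w') e.
Qed.

Lemma card_support_move w : #|choice_support (move_choice w)| = #|choice_support w|.
Proof.
have s1_inj : injective (fun v => (s (v, ord0)).1).
  by move=> u v /eqP; rewrite s_block => /eqP.
rewrite -[RHS](card_imset _ s1_inj); apply: eq_card => v; rewrite mem_choice_support.
apply/existsP/imsetP => [[j]|[u]].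
  rewrite -[(v, j)](permKV s) chosen_move => cj; exists (s^-1%g (v, j)).1.
    rewrite mem_choice_support; apply/existsP; exists (s^-1%g (v, j)).2.
    by rewrite -surjective_pairing.
  by apply/eqP; rewrite -[v]/((v, j).1) -[X in X.1 == _](permKV s) s_block.
rewrite mem_choice_support => /existsP[l cl] ->; exists (s (u, l)).2.
have -> : (s (u, ord0)).1 = (s (u, l)).1 by apply/eqP; rewrite s_block.
by rewrite -surjective_pairing chosen_move.
Qed.

Lemma partner_move w x : chosen w x -> partner (move_choice w) (s x) = s (partner w x).
Proof.
move=> cx; apply: partner_unique; rewrite ?chosen_move ?chosen_partner //.
  by apply/eqP; rewrite s_block partner1.
by rewrite (inj_eq perm_inj) eq_sym partner_neq.
Qed.

Variables (Ga Ga' : tgraph N).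
Hypothesis Ga_s : forall x, Ga' (s x) = s (Ga x).

Lemma contract_move w x : contract Ga' (move_choice w) (s x) = s (contract Ga w x).
Proof.
by apply: surgery_conj => // y; [exact: chosen_move | exact: partner_move].
Qed.

Lemma card_circles_move w : #|circles Ga' (move_choice w)| = #|circles Ga w|.
Proof.
by apply: (card_circles_conj (s := s)) => // y; [exact: chosen_move | exact: partner_move].
Qed.

End Move.
End Choices.

(** * Contraction as an operator on tensors *)

Section ContractionOperator.
Variables (n M N : nat) (nM : n = (M * 2)%N).
Variables (f : 'I_n -> 'I_N * 'I_3) (f' : 'I_N * 'I_3 -> 'I_n).
Hypotheses (fK : cancel f f') (f'K : cancel f' f).
Variables (D : finType) (J : D -> D -> rat).
Hypothesis JN : forall i j, J i j = - J j i.
Hypothesis JJ : forall i k, \sum_j J i j * J j k = - (i == k)%:R.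
Local Notation pairT := (pairing fK f'K J).

(* As L does not depend on Ga, every linear relation between the forms of     *)
(* graphs is inherited by the contracted graphs.                              *)
Lemma contraction_operator (w : {ffun 'I_N -> option half_edge_pair}) :
  exists L : {ffun {ffun 'I_N * 'I_3 -> D} -> rat} ->
             {ffun {ffun 'I_N * 'I_3 -> D} -> rat},
  forall (Ga : tgraph N) t, pairT Ga (L t) =
    (-1) ^+ #|choice_support w| * (- #|D|%:R) ^+ #|circles Ga w| *
    pairT (contract Ga w) t.
Proof.
move sE : #|choice_support w| => k; elim: k w sE => [|k IH] w sE.
  have w0 v : w v = None.
    have /eqP/setP/(_ v) : choice_support w == set0 by rewrite -cards_eq0 sE.
    by rewrite !inE; case: (w v).
  have ch0 x : chosen w x = false by rewrite /chosen w0.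
  exists id => Ga t; rewrite expr0 mul1r.
  have -> : contract Ga w = Ga.
    apply/val_inj/ffunP => x; apply: (@surgery_exit _ _ _ _ _ _ _ x 0%N) => //.
      by rewrite ch0.
    by rewrite ch0.
  suff -> : circles Ga w = set0 by rewrite cards0 expr0 mul1r.
  apply/setP => B; rewrite !inE; apply/negP => /andP[/imsetP[x _ ->] /subsetP/(_ x)].
  by rewrite !inE connect0 => /(_ isT); rewrite -[_ \in _]/(chosen w x) ch0.
have [v wv] : exists v, v \in choice_support w.
  by apply/set0Pn; rewrite -cards_eq0 sE.
move: (wv); rewrite inE; case wvE: (w v) => [B|] // _.
have /set0Pn[i iB] : val B != set0 by rewrite -card_gt0 (eqP (valP B)).
(* The choice at [v] is dropped; the induction hypothesis treats the others. *)
pose w1 := [ffun u => if u == v then None else w u].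
have [|L LE] := IH w1.
  have -> : choice_support w1 = choice_support w :\ v.
    by apply/setP => u; rewrite !inE ffunE; case: eqVneq.
  by apply: succn_inj; rewrite -sE (cardsD1 v (choice_support w)) wv.
pose a := (v, i); pose b := (v, other B i).
have ca : chosen w a by rewrite /chosen /= wvE.
have qa : partner w a = b by rewrite /partner /= wvE.
have w1E x : chosen w1 x = [&& chosen w x, x != a & x != b].
  case: x => u l; rewrite /chosen ffunE /= !xpair_eqE.
  have [->|uv] := eqVneq u v; last by rewrite /= !andbT.
  rewrite wvE (half_edge_pairE iB) !inE /=.
  by case: (l == i) => //=; case: (l == other B i).
have p1E x : chosen w1 x -> partner w1 x = partner w x.
  by rewrite /chosen /partner ffunE; case: eqVneq.
have ab : a != b by rewrite -qa eq_sym partner_neq.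
(* The graph is first cut at [v]; [L], which serves all graphs at once, is then used for the graph
   so obtained. *)
exists (fun t => contract_pair J a b (L t)) => Ga t.
rewrite (pairing_surgery nM fK f'K JN JJ) // LE.
have -> : contract (pair_surgery Ga a b) w1 = contract Ga w.
  exact: (surgery_pair_surgery _ _ _ _ _ _ _ ca qa w1E p1E).
have -> : #|circles Ga w| = ((Ga a == b) + #|circles (pair_surgery Ga a b) w1|)%N.
  by apply: (card_circles_pair_surgery (S1 := chosen w1) _ _ _ _ _ _ ca qa w1E p1E);
     move=> x; [exact: partnerK | exact: partner_neq | exact: chosen_partner
               | exact: partnerK | exact: chosen_partner].
have alg (x y s p : rat) : - x * (s * y * p) = -1 * s * (x * y) * p by ring.
by rewrite exprD exprS alg.
Qed.

Definition block_antisymmetric (t : {ffun {ffun 'I_N * 'I_3 -> D} -> rat}) :=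
  forall (s : {perm 'I_N * 'I_3}) (c : {ffun 'I_N * 'I_3 -> D}),
    (forall x y, ((s x).1 == (s y).1) = (x.1 == y.1)) ->
  t [ffun x => c (s x)] = (-1) ^+ s * t c.

(** The sign of [s] enters once through the form and once through the tensor, and cancels. *)
Lemma pairing_iso (Ga Ga' : tgraph N) (s : {perm 'I_N * 'I_3}) t :
    block_antisymmetric t ->
    (forall x y, ((s x).1 == (s y).1) = (x.1 == y.1)) ->
    (forall x, Ga' (s x) = s (Ga x)) ->
  pairT Ga' t = pairT Ga t.
Proof.
move=> ta s1 Gs; rewrite /pairing.
have h_inj : injective (fun c : {ffun 'I_N * 'I_3 -> D} => [ffun x => c (s x)]).
  move=> c c' /ffunP e; apply/ffunP => x.
  by have := e (s^-1%g x); rewrite !ffunE permKV.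
rewrite [RHS](reindex_inj h_inj); apply: eq_bigr => c _.
rewrite (beta_relabel nM fK f'K JN c Gs) ta // [RHS]mulrCA mulrA.
have -> // : c \o s = [ffun x => c (s x)].
by apply: funext => x; rewrite ffunE.
Qed.

End ContractionOperator.

(** * Antisymmetry of the cup power *)

Section WedgeAntisymmetry.
Variable g : nat.

(** The same matrix acts on the three factors, so the action commutes with permuting them. *)
Lemma alternating_tensor_act (A : 'M[rat]_(g + g)) (t : tensor g 'I_3) :
  alternating t -> alternating (tensor_act A t).
Proof.
move=> ta s I; rewrite !ffunE mulr_sumr.
have h_inj : injective (fun c : {ffun 'I_3 -> 'I_(g + g)} => [ffun x => c (s x)]).
  move=> c c' /ffunP e; apply/ffunP => x.
  by have := e (s^-1%g x); rewrite !ffunE permKV.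
rewrite (reindex_inj h_inj); apply: eq_bigr => K _; rewrite ta mulrCA; congr (_ * (_ * _)).
rewrite [RHS](reindex_inj (@perm_inj _ s)); apply: eq_bigr => p _.
by rewrite !ffunE.
Qed.

(** Inside a block the sign comes from alternation. A permutation of the blocks reindexes the sum
    over ['S_N], and has the same sign on half-edges because three is odd. *)
Lemma wedge_antisymmetric (N : nat) (t : 'I_N -> tensor g 'I_3) :
  (forall v, alternating (t v)) -> block_antisymmetric (wedge t).
Proof.
move=> ta s c s1.
pose W (c' : 'I_N * 'I_3 -> 'I_(g + g)) := wedge t (finfun c').
have -> : wedge t c = W c by congr (wedge t _); apply/ffunP => x; rewrite ffunE.
apply: (block_antisymmetry ord0 (W := W)) => // [a u|u] {}c; rewrite /W !ffunE.
  rewrite mulr_sumr; apply: eq_bigr => tau _; rewrite mulrCA; congr (_ * _).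
  rewrite (bigD1 a) // [in RHS](bigD1 a) //= mulrA; congr (_ * _).
    rewrite -ta; congr (t _ _); apply/ffunP => j.
    by rewrite !ffunE /fiber_fun /= eqxx.
  apply: eq_bigr => v /negPf va; congr (t _ _); apply/ffunP => j.
  by rewrite !ffunE /fiber_fun /= va.
rewrite card_ord /= mulr_sumr (reindex_inj (mulgI u)).
apply: eq_bigr => tau _; rewrite odd_permM signr_addb -mulrA; congr (_ * (_ * _)).
rewrite [RHS](reindex_inj (@perm_inj _ u)); apply: eq_bigr => v _.
by rewrite permM; congr (t _ _); apply/ffunP => j; rewrite !ffunE.
Qed.

End WedgeAntisymmetry.

(** * Vanishing on the Young modules *)

Section Vanishing.
Variables (n M : nat) (nM : n = (M * 2)%N).
Variables (D : finType) (J : D -> D -> rat).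
Hypothesis JN : forall i j, J i j = - J j i.

(* The coefficient at the basis tensor c of the form attached to xi. *)
Definition chord_eval (xi : QD n) (c : 'I_n -> D) : rat :=
  \sum_C xi C * beta (f := id) (f' := id) (fun=> erefl) (fun=> erefl) J C c.

Lemma relabelE (s : 'S_n) (C : chord_diagram n) i : relabel s C (s i) = s (C i).
Proof. by rewrite ffunE permK. Qed.

Lemma relabelK s : cancel (@relabel n s) (relabel s^-1).
Proof.
move=> C; apply/val_inj/ffunP => i; rewrite -[LHS]/(relabel s^-1 (relabel s C) i).
by rewrite -{1}[i](permK s) relabelE relabelE permK.
Qed.

(** Through [beta_relabel], symmetry of [xi] becomes antisymmetry of its form. *)
Lemma chord_eval_act s xi c :
  chord_eval (QD_act s xi) c = (-1) ^+ s * chord_eval xi (c \o s).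
Proof.
rewrite /chord_eval (reindex_inj (can_inj (relabelK s))) mulr_sumr.
apply: eq_bigr => C _; rewrite ffunE relabelK [RHS]mulrCA; congr (_ * _).
by rewrite (beta_relabel nM _ _ JN c (relabelE s C)).
Qed.

Lemma chord_eval_sum (I : finType) (a : I -> rat) (xi : I -> QD n) c :
  chord_eval (\sum_i a i *: xi i) c = \sum_i a i * chord_eval (xi i) c.
Proof.
rewrite /chord_eval; under [RHS]eq_bigr => i _ do rewrite mulr_sumr.
rewrite exchange_big; apply: eq_bigr => C _; rewrite sum_ffunE mulr_suml.
by apply: eq_bigr => i _; rewrite ffunE -mulrA.
Qed.

(** The row permutation is applied last in [(q * p)%g], so left translation by a row permutation
    only reindexes the sum over the row group. *)
Lemma young_symmetrizer_row (sh : seq nat) (p : 'S_n) : row_group sh p ->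
  QS_act p (young_symmetrizer n sh) = young_symmetrizer n sh.
Proof.
move=> /forallP rp; apply/ffunP => u; rewrite !ffunE.
rewrite [RHS](reindex_inj (mulIg p)); apply: eq_big => [p'|p' _].
  apply: eq_forallb => i; rewrite permM.
  by rewrite (eqP (rp (p' i))).
apply: eq_bigr => q _; congr (_ * _%:R).
by rewrite mulgA (can2_eq (mulgKV p) (mulgK p)).
Qed.

Lemma QS_act1 (x : QS n) : QS_act 1 x = x.
Proof. by apply/ffunP => u; rewrite ffunE invg1 mulg1. Qed.

Lemma reshape_index0 (r : nat) (sh : seq nat) i : (i < r)%N ->
  reshape_index (r :: sh) i = 0%N.
Proof. by move=> ir; rewrite /reshape_index /= -subn_eq0 in ir *; rewrite ir. Qed.

(* The form is antisymmetric in the slots of the first row, which are more    *)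
(* numerous than the basis vectors.                                           *)
Lemma chord_eval_young (r : nat) (la : seq nat) (E : {vspace QD n}) xi c :
    (r.*2 <= n)%N -> (#|D| < r.*2)%N ->
  is_E (r :: la) E -> xi \in E -> chord_eval xi c = 0.
Proof.
move=> rn Dr [_ [F [FE _ <-]]]; set sh := [seq l.*2 | l <- _] in FE *.
set y := young_symmetrizer n sh; pose X := [seq QS_act s y | s : 'S_n].
have XV x : x \in X -> x \in young_module n sh by exact: memv_span.
have actX s : QS_act s y \in X by apply: image_f.
have yV : y \in young_module n sh by rewrite -[y]QS_act1; apply: XV; exact: actX.
have Fy0 c' : chord_eval (F y) c' = 0.
  (* Pigeonhole: two of the slots of the first row carry the same basis vector. *)
  have [i [j [ij ir jr cij]]] : exists i j : 'I_n,
      [/\ i != j, (i < r.*2)%N, (j < r.*2)%N & c' i = c' j].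
    pose h (i : 'I_(r.*2)) := c' (widen_ord rn i).
    have /injectivePn[i [j ij hij]] : ~~ injectiveb h.
      apply/injectiveP => /leq_card; rewrite card_ord; lia.
    exists (widen_ord rn i), (widen_ord rn j).
    split; [|exact: (ltn_ord i)|exact: (ltn_ord j)|exact: hij].
    by apply/eqP => /(congr1 val) /= /val_inj e; rewrite e eqxx in ij.
  have row : row_group sh (tperm i j).
    apply/forallP => l; apply/eqP; case: tpermP => [->|->|//];
    by rewrite /sh /= !reshape_index0.
  (* Exchanging the slots [i] and [j] fixes both [F y] and [c'] but has sign [-1], so the value is
     its own opposite. *)
  have := chord_eval_act (tperm i j) (F y) c'.
  rewrite -FE // young_symmetrizer_row // odd_tperm ij mulN1r.
  have -> : c' \o tperm i j = c'.
    by apply: funext => l /=; case: tpermP => [->|->|//].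
  by move/eqP; rewrite -addr_eq0 -mulr2n mulrn_eq0 => /eqP.
case/memv_imgP => x; rewrite /young_module -/y -/X => xV ->.
(* An element of [E] is a combination of translates of [F y], to which the vanishing extends by
   equivariance. *)
have xE := @coord_span _ _ _ (in_tuple X) x xV.
rewrite xE linear_sum /=; under eq_bigr => i _ do rewrite linearZ /=.
rewrite chord_eval_sum big1 // => i _.
have /imageP[s _ ->] : X`_i \in X by rewrite mem_nth.
by rewrite FE // chord_eval_act Fy0 !mulr0.
Qed.

End Vanishing.

(** * The symplectic form and the cochain of a graph *)

Section Symplectic.
Variable g : nat.

Lemma symp_antisym i j : symp g i j = - symp g j i.
Proof.
have -> : symp g i j = (symp g)^T j i by rewrite [RHS]mxE.
rewrite /symp tr_block_mx !trmx0 linearN /= trmx1.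
suff <- : - symp g = block_mx 0 (- 1%:M) 1%:M 0 by rewrite [LHS]mxE.
by rewrite /symp opp_block_mx !oppr0 opprK.
Qed.

Lemma symp_sqr i k : \sum_j symp g i j * symp g j k = - (i == k)%:R.
Proof.
have : symp g *m symp g = - 1%:M.
  rewrite /symp mulmx_block !mul0mx !mulmx0 !add0r !addr0 mulmxN mul1mx mulNmx mul1mx.
  by rewrite scalar_mx_block opp_block_mx !oppr0.
by move/matrixP/(_ i k); rewrite mxE => ->; rewrite !mxE.
Qed.

End Symplectic.

Lemma chord_count k : (6 * k = (3 * k) * 2)%N.
Proof. lia. Qed.

Section AlphaGraph.
Variables (g k : nat) (G : groupType).
Variables (rho : G -> 'M[rat]_(g + g)) (kt : G -> tensor g 'I_3).
Hypothesis kt_alt : forall a, alternating (kt a).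
Local Notation T := ('I_(2 * k) * 'I_3)%type.
Local Notation pairT := (pairing (@point_half_edgeK k) (@half_edge_pointK k) (symp g)).

Lemma alpha_graphE (Ga : tgraph (2 * k)) (x : 'I_(2 * k) -> G) :
  alpha_graph rho kt Ga x = pairT Ga (cup_power rho kt x).
Proof.
pose h (I : {ffun 'I_(6 * k) -> 'I_(g + g)}) : {ffun T -> 'I_(g + g)} :=
  [ffun y => I (half_edge_point y)].
have h_bij : bijective h.
  exists (fun c : {ffun T -> 'I_(g + g)} => [ffun i => c (point_half_edge i)]) => c;
  by apply/ffunP => i; rewrite !ffunE ?point_half_edgeK ?half_edge_pointK.
rewrite /alpha_graph /alpha_form /pairing mulr_sumr.
rewrite [RHS](reindex h) /=; last exact: onW_bij.
apply: eq_bigr => I _; rewrite ffunE mulrCA mulrC; congr (_ * _).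
rewrite /beta; congr (_ * _); apply: eq_bigr => i _.
by rewrite [h I (point_half_edge i)]ffunE [h I (point_half_edge _)]ffunE !point_half_edgeK.
Qed.

Lemma cup_power_antisymmetric (x : 'I_(2 * k) -> G) :
  block_antisymmetric (cup_power rho kt x).
Proof. by apply: wedge_antisymmetric => v; exact: alternating_tensor_act. Qed.

Lemma tgraph_class_repr (Ga : tgraph (2 * k)) : exists2 s : {perm T},
  forall y z, ((s y).1 == (s z).1) = (y.1 == z.1) &
  forall y, repr (class_of Ga) (s y) = s (Ga y).
Proof.
have : tgraph_iso Ga (repr (class_of Ga)).
  by rewrite tgraph_iso_sym; apply/eqmodP; rewrite reprK.
case/existsP=> s /andP[/forallP s1 /forallP s2]; exists s => y.
  by move=> z; have /forallP/(_ z)/eqP := s1 y.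
by rewrite (eqP (s2 y)).
Qed.

(** The antisymmetry of the cup power makes the value independent of the representative of the
    class. *)
Lemma alpha_class (Ga : tgraph (2 * k)) x :
  alpha rho kt << class_of Ga >> x = pairT Ga (cup_power rho kt x).
Proof.
rewrite /alpha liftU scale1r alpha_graphE.
have [s s1 s2] := tgraph_class_repr Ga.
exact: (pairing_iso (chord_count k) _ _ (@symp_antisym g) (cup_power_antisymmetric x) s1 s2).
Qed.

End AlphaGraph.

(** * Contraction and alpha *)

Section AlphaContraction.
Variables (g k : nat) (G : groupType).
Variables (rho : G -> 'M[rat]_(g + g)) (kt : G -> tensor g 'I_3).
Hypothesis kt_alt : forall a, alternating (kt a).
Local Notation T := ('I_(2 * k) * 'I_3)%type.
Local Notation pairT := (pairing (@point_half_edgeK k) (@half_edge_pointK k) (symp g)).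

Lemma alphaZ (a : rat) (y : graph_space (2 * k)) x :
  alpha rho kt (a *: y) x = a * alpha rho kt y x.
Proof. by rewrite /alpha linearZ. Qed.

Lemma alpha_sum (I : Type) (r : seq I) (P : pred I) (F : I -> graph_space (2 * k)) x :
  alpha rho kt (\sum_(i <- r | P i) F i) x = \sum_(i <- r | P i) alpha rho kt (F i) x.
Proof. by rewrite /alpha raddf_sum. Qed.

Lemma contraction_sum (p : nat) (xi : QD (6 * k)) :
  contraction g p (graph_of_xi xi) =
  \sum_C xi C *: contraction g p << class_of (graph_of_chords C) >>.
Proof.
rewrite /contraction /graph_of_xi raddf_sum /=; apply: eq_bigr => C _.
exact: linearZ.
Qed.

(** The double sum collapses because [w] determines [F]; an isomorphism from [Ga] to the
    representative of its class then reindexes the choices. *)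
Lemma alpha_contraction (p : nat) (Ga : tgraph (2 * k)) x :
  alpha rho kt (contraction g p << class_of Ga >>) x =
  ((2 * g)%:R - 2) ^- p * \sum_(w | #|choice_support w| == p)
    ((-1) ^+ #|choice_support w| * (- (2 * g)%:R) ^+ #|circles Ga w| *
     pairT (contract Ga w) (cup_power rho kt x)).
Proof.
rewrite /contraction liftU scale1r alphaZ; congr (_ * _).
have [s s1 s2] := tgraph_class_repr Ga; set Ga' := repr _ in s2 *.
transitivity (\sum_(w | #|choice_support w| == p)
    ((-1) ^+ #|choice_support w| * (- (2 * g)%:R) ^+ #|circles Ga' w| *
     pairT (contract Ga' w) (cup_power rho kt x))).
  rewrite alpha_sum; under eq_bigr => F _ do rewrite alpha_sum.
  rewrite (exchange_big_dep (fun w => #|choice_support w| == p)) /=.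
    apply: eq_bigr => w /eqP wp; rewrite (big_pred1 (choice_support w)) => [|F].
      by rewrite alphaZ alpha_class // wp.
    apply/andP/eqP => [[_ /forallP Fw]|->].
      by apply/setP => v; rewrite inE (eqP (Fw v)).
    by rewrite wp eqxx; split=> //; apply/forallP => v; rewrite inE.
  move=> F w /eqP <- /forallP Fw; apply/eqP/eq_card => v.
  by rewrite inE (eqP (Fw v)).
rewrite (reindex_inj (move_choice_inj s1)); apply: eq_big => [w|w _].
  by rewrite card_support_move.
rewrite card_support_move // (card_circles_move s1 s2); congr (_ * _).
apply: (pairing_iso (chord_count k) _ _ (@symp_antisym g) _ s1).
  exact: cup_power_antisymmetric.
exact: contract_move.
Qed.

Lemma chord_eval_pairing (xi : QD (6 * k)) (t : tensor g T) :
  (forall c, chord_eval (symp g) xi c = 0) ->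
  \sum_C xi C * pairT (graph_of_chords C) t = 0.
Proof.
move=> xi0; rewrite /pairing; under eq_bigr => C _ do rewrite mulr_sumr.
rewrite exchange_big big1 // => c _.
transitivity (chord_eval (symp g) xi (c \o @point_half_edge k) * t c); last first.
  by rewrite xi0 mul0r.
rewrite /chord_eval mulr_suml.
apply: eq_bigr => C _; rewrite mulrA; congr (_ * _ * _).
rewrite /beta; have -> : chords_on (@point_half_edgeK k) (@half_edge_pointK k)
    (graph_of_chords C) = C.
  by apply/val_inj/ffunP => i; rewrite !ffunE !point_half_edgeK.
have -> // : chords_on (f := id) (f' := id) (fun=> erefl) (fun=> erefl) C = C.
by apply/val_inj/ffunP => i; rewrite ffunE.
Qed.

(** All diagrams share the same half-edges, so the sums over [C] and [w] can be exchanged. For fixed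
    [w] the operator [L] turns the sum over [C] into the zero form of [xi] evaluated at another
    tensor. *)
Lemma alpha_contraction_eq0 (p : nat) (xi : QD (6 * k)) x :
  (forall c, chord_eval (symp g) xi c = 0) ->
  alpha rho kt (contraction g p (graph_of_xi xi)) x = 0.
Proof.
move=> xi0; rewrite contraction_sum alpha_sum.
under eq_bigr => C _ do rewrite alphaZ alpha_contraction mulrCA mulr_sumr.
rewrite -mulr_sumr exchange_big /= big1 ?mulr0 // => w _.
have [L LE] := contraction_operator (chord_count k) (@point_half_edgeK k) (@half_edge_pointK k)
  (@symp_antisym g) (@symp_sqr g) w.
rewrite -[RHS](chord_eval_pairing (L (cup_power rho kt x)) xi0).
by apply: eq_bigr => C _; rewrite LE card_ord (mul2n g) -addnn.
Qed.

End AlphaContraction.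

Theorem theorem6p3 (R : realType) (g k : nat)
    (X : topologicalType) (x0 : X) (z : chain int R X 2)
    (h : {linear chain rat R X 1 -> 'cV[rat]_(g + g)})
    (rho : mcg x0 z -> 'M[rat]_(g + g)) (kt : mcg x0 z -> tensor g 'I_3)
    (la : seq nat) (E : {vspace QD (6 * k)}) :
  (2 <= g)%N -> (1 <= k)%N ->
  closed_surface R X -> fundamental_cycle z -> symplectic_marking z h ->
  homology_action h rho -> crossed_hom rho kt -> extends_johnson h kt ->
  young_diagram (3 * k) la -> (g < head 0%N la)%N -> is_E la E ->
  (forall xi : QD (6 * k), xi \in E ->
     null_cohomologous (alpha rho kt (graph_bar g (graph_of_xi xi)))) /\
  (forall (xi : QD (6 * k)) (p : nat), xi \in E -> (p <= 2 * k)%N ->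
     null_cohomologous (alpha rho kt (contraction g p (graph_of_xi xi)))).
Proof.
move=> _ k_gt0 _ _ _ _ [kt_alt _] _ /and3P[_ _ la_sum] g_la EE.
(* The degree [2 * k] is positive, so a coboundary is required: the zero cochain is that of zero. *)
have null (c : cochain (mcg x0 z) (2 * k)) : (forall x, c x = 0) -> null_cohomologous c.
  move: c; rewrite -[(2 * k)%N]prednK ?muln_gt0 // => c c0.
  exists (fun=> 0) => x; rewrite c0 /coboundary big1 => [|i _]; last by rewrite mulr0.
  by rewrite mulr0 !addr0.
have vanish xi p x : xi \in E -> alpha rho kt (contraction g p (graph_of_xi xi)) x = 0.
  case: la la_sum g_la EE => // r la /eqP/= la_sum g_la EE xiE.
  apply: alpha_contraction_eq0 => // c.
  (* The first row of the doubled diagram has [2 * r] boxes, at most [6 * k] and more than the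
     [2 * g] basis vectors. *)
  apply: (chord_eval_young (chord_count k) (@symp_antisym g) _ _ _ EE xiE); first lia.
  by rewrite card_ord; lia.
split=> [xi xiE|xi p xiE _]; apply: null => x; last exact: vanish.
rewrite /graph_bar alpha_sum big1 // => p _.
by rewrite alphaZ vanish ?mulr0.
Qed.
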